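(* Let $X$ and $\Sigma$ be compact orientable manifolds, let $\mathcal{A}_X \to X$ be a Lie algebroid of rank $4$ and $\mathcal{A}_\Sigma \to \Sigma$ a Lie algebroid of rank $2$, and let $(\varphi,f)\colon \mathcal{A}_X \to \mathcal{A}_\Sigma$ be a Lie algebroid Lefschetz fibration with connected fibers. Assume that $\mathcal{A}_\Sigma$ admits a symplectic structure and that there exists a closed $\mathcal{A}_X$-two-form $\eta$ such that $\eta|_{\ker\varphi}$ is nondegenerate. Then $X$ admits an $\mathcal{A}_X$-symplectic structure.
   Context: A Lie algebroid over a manifold $X$ is a vector bundle $\mathcal{A}\to X$ with a Lie bracket $[\cdot,\cdot]_{\mathcal A}$ on $\Gamma(\mathcal{A})$ and a vector bundle map $\rho_{\mathcal A}\colon \mathcal{A}\to TX$ (the anchor) with $[v,gw]_{\mathcal A}=g[v,w]_{\mathcal A}+(\mathcal{L}_{\rho_{\mathcal A}(v)}g)\,w$ for $v,w\in\Gamma(\mathcal A)$, $g\in C^\infty(X)$. The $\mathcal{A}$-forms $\Omega^\bullet_{\mathcal A}(X)=\Gamma(\wedge^\bullet\mathcal{A}^* )$ carry the differential $d_{\mathcal A}$ given by the Koszul formula; closed means $d_{\mathcal A}$-closed. An $\mathcal{A}$-symplectic structure (a symplectic structure on $\mathcal{A}$) is a closed nondegenerate $\mathcal{A}$-two-form. The isomorphism locus $X_{\mathcal A}\subseteq X$ is the open set where $\rho_{\mathcal A}$ is an isomorphism. A Lie algebroid morphism $(\varphi,f)\colon\mathcal{A}_X\to\mathcal{A}_Y$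 is a vector bundle map $\varphi$ covering a smooth map $f\colon X\to Y$ such that $\varphi^*\colon\Omega^\bullet(\mathcal{A}_Y)\to\Omega^\bullet(\mathcal{A}_X)$ is a chain map. It is a Lie algebroid fibration if $\varphi$ is fiberwise surjective. A Lefschetz fibration is a proper map $f\colon X^{2n}\to\Sigma^2$ between oriented connected manifolds which is injective on critical points and such that around each critical point $x$ and around $f(x)$ there are orientation preserving complex coordinate charts centered at $x$ and $f(x)$ in which $f(z_1,\dots,z_n)=z_1^2+\dots+z_n^2$. A Lie algebroid Lefschetz fibration $(\varphi,f)\colon\mathcal{A}_X\to\mathcal{A}_\Sigma$ (with $\mathcal{A}_X$ of rank $2n$ and $\mathcal{A}_\Sigma$ of rank $2$) is a Lie algebroid morphism which is a Lie algebroid fibration outside a discrete set $\Delta\subset X_{\mathcal{A}_X}$ with $f(\Delta)\subset\Sigma_{\mathcal{A}_\Sigma}$, and such that $f|_{X_{\mathcal{A}_X}}\colon X_{\mathcal{A}_X}\to\Sigma_{\mathcal{A}_\Sigma}$ is a Lefschetz fibration. (If $X_{\mathcal{A}_X}=\emptyset$ this just means Lie algebroid fibration.) Connected fibers means that the generic fibers of $f$ in $X_{\mathcal{A}_X}$ are connected. *)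

(* Defs.v *)
From HB Require Import structures.
From mathcomp Require Import all_boot all_order all_algebra.
From mathcomp Require Import all_classical all_reals all_analysis.
From mathcomp Require Import complex.

Set Implicit Arguments.
Unset Strict Implicit.
Unset Printing Implicit Defensive.

Import Order.TTheory GRing.Theory Num.Theory numFieldNormedType.Exports.

Local Open Scope classical_set_scope.
Local Open Scope ring_scope.

(* C^k and smooth functions on an open set O of a normed space V, meant for
   finite-dimensional V (where "Df is C^k" means that every directional
   derivative is C^k); the values of f outside O are irrelevant. *)
Fixpoint Ck (R : realType) (V W : normedModType R) (k : nat)
    (O : set V) (f : V -> W) : Prop :=
  if k is k'.+1 then
    (forall x, O x -> differentiable f x) /\
    (forall v : V, Ck k' O ('D_v f))
  else forall x, O x -> {for x, continuous f}.

Definition smooth_on (R : realType) (V W : normedModType R)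
    (O : set V) (f : V -> W) : Prop :=
  forall k, Ck k O f.

(* [coordV] is only meaningful on the image of [cdom] by [coord]. *)
Record chart (R : realType) (n : nat) (T : topologicalType) := Chart {
  cdom : set T;
  coord : T -> 'rV[R]_n;
  coordV : 'rV[R]_n -> T }.

Section Charts.
Variables (R : realType) (n : nat) (T : topologicalType).
Implicit Types c d : chart R n T.

Definition cimg c : set 'rV[R]_n := coord c @` cdom c.

Definition is_chart c : Prop :=
  [/\ open (cdom c) /\ open (cimg c),
      forall x, cdom c x -> coordV c (coord c x) = x,
      forall x, cdom c x -> {for x, continuous (coord c)} &
      forall u, cimg c u -> {for u, continuous (coordV c)}].

Definition transition c d : 'rV[R]_n -> 'rV[R]_n := coord d \o coordV c.

Definition compatible c d : Prop :=
  smooth_on (coord c @` (cdom c `&` cdom d)) (transition c d) /\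
  smooth_on (coord d @` (cdom d `&` cdom c)) (transition d c).

Definition same_orientation c d : Prop :=
  forall x, cdom c x -> cdom d x ->
    0 < \det (jacobian (transition c d) (coord c x)).

End Charts.

(* Smooth n-manifolds without boundary, possibly empty or disconnected; the
   atlas need not be maximal. *)
Record manifold (R : realType) (n : nat) := Manifold {
  mspace :> topologicalType;
  atlas : set (chart R n mspace);
  mhausdorff : hausdorff_space mspace;
  msecond_countable : @second_countable mspace;
  atlas_chart : forall c, atlas c -> is_chart c;
  atlas_cover : forall x, exists2 c, atlas c & cdom c x;
  atlas_compatible : forall c d, atlas c -> atlas d -> compatible c d }.

Section Manifolds.
Variables (R : realType) (n : nat) (X : manifold R n).

Definition smooth_chart (c : chart R n X) : Prop :=
  is_chart c /\ forall d, atlas d -> compatible c d.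

(* Smoothness of a vector-valued function on an open subset U of X. *)
Definition smooth_fun (W : normedModType R) (U : set X) (g : X -> W) : Prop :=
  forall c, atlas c -> smooth_on (coord c @` (U `&` cdom c)) (g \o coordV c).

Definition smooth (g : X -> R) : Prop := smooth_fun setT g.

(* T_x X is the space of point derivations of C^oo(X) at x.  Derivations are
   extended by 0 to the non-smooth functions, so that two tangent vectors
   are equal exactly when they agree on C^oo(X). *)
Definition tangent (x : X) : set ((X -> R) -> R) :=
  [set D | [/\ forall (a : R) (g h : X -> R), smooth g -> smooth h ->
                 D (fun y => a * g y + h y) = a * D g + D h,
               forall g h : X -> R, smooth g -> smooth h ->
                 D (fun y => g y * h y) = D g * h x + g x * D h &
               forall g : X -> R, ~ smooth g -> D g = 0]].

(* An orientation of the open submanifold U, given by an oriented atlas. *)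
Definition orientation (U : set X) (o : set (chart R n X)) : Prop :=
  [/\ forall c, o c -> smooth_chart c /\ cdom c `<=` U,
      forall x, U x -> exists2 c, o c & cdom c x &
      forall c d, o c -> o d -> same_orientation c d].

Definition orientable : Prop := exists o, orientation setT o.

Definition oriented_chart (o : set (chart R n X)) (c : chart R n X) : Prop :=
  smooth_chart c /\ forall d, o d -> same_orientation c d.

End Manifolds.

Section Maps.
Variables (R : realType) (m p : nat) (X : manifold R m) (Y : manifold R p).

Definition smooth_map (f : X -> Y) : Prop :=
  continuous f /\
  forall c d, atlas c -> atlas d ->
    smooth_on (coord c @` (cdom c `&` f @^-1` cdom d))
              (coord d \o f \o coordV c).

(* The differential of f sends a derivation D to [fun g => D (g \o f)]. *)
Definition regular_point (f : X -> Y) (x : X) : Prop :=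
  forall E, tangent (f x) E ->
    exists2 D, tangent x D & forall g : Y -> R, smooth g -> D (g \o f) = E g.

Definition critical_point (f : X -> Y) (x : X) : Prop := ~ regular_point f x.

End Maps.

Arguments regular_point {R m p X Y} f x.
Arguments critical_point {R m p X Y} f x.

(* The space R^(2n) is identified with C^n by
   z_j = x_(2j) + i x_(2j+1) (0 <= j < n), so that the orientation of C^n as
   a complex vector space is the standard orientation of R^(2n).  The
   dimension N of the row vector is only used with N = 2n. *)
Definition nthcoord (R : realType) (N : nat) (u : 'rV[R]_N) (k : nat) : R :=
  oapp (fun i : 'I_N => u 0 i) 0 (insub k).

Definition zcoord (R : realType) (N : nat) (u : 'rV[R]_N) (j : nat) : R[i] :=
  Complex (nthcoord u j.*2) (nthcoord u j.*2.+1).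

Section Lefschetz.
Variables (R : realType) (m p : nat) (X : manifold R m) (Y : manifold R p).

Definition lefschetz_point (n : nat) (U : set X) (V : set Y)
    (oU : set (chart R m X)) (oV : set (chart R p Y)) (f : X -> Y) (x : X) :=
  exists (c : chart R m X) (d : chart R p Y),
    [/\ oriented_chart oU c /\ oriented_chart oV d,
        cdom c `<=` U /\ cdom d `<=` V,
        [/\ cdom c x, coord c x = 0, cdom d (f x) & coord d (f x) = 0],
        f @` cdom c `<=` cdom d &
        forall y, cdom c y ->
          zcoord (coord d (f y)) 0 = \sum_(j < n) zcoord (coord c y) j ^+ 2].

(* The restriction f : U -> V is a Lefschetz fibration, where U and V are open
   submanifolds of X and Y (smoothness of f is required separately). *)
Definition lefschetz_fibration (n : nat) (U : set X) (V : set Y) (f : X -> Y) :=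
  [/\ m = n.*2 /\ p = 2%N,
      f @` U `<=` V,
      connected U /\ connected V,
      forall K, K `<=` V -> compact K -> compact (U `&` f @^-1` K) &
      set_inj (U `&` critical_point f) f /\
      exists oU oV, [/\ orientation U oU, orientation V oV &
        forall x, U x -> critical_point f x ->
          lefschetz_point n U V oU oV f x]].

End Lefschetz.

(* A smooth real vector bundle of rank r: a family of vector spaces with local
   trivializations [triv i x : E_x -> R^r] (isomorphisms for x in
   [triv_dom i]) whose transition functions are smooth. *)
Record vbundle (R : realType) (n : nat) (X : manifold R n) (r : nat) := VBundle {
  fibre :> X -> lmodType R;
  triv_idx : Type;
  triv_dom : triv_idx -> set X;
  triv : triv_idx -> forall x, {linear fibre x -> 'rV[R]_r};
  trivV : triv_idx -> forall x, 'rV[R]_r -> fibre x;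
  triv_open : forall i, open (triv_dom i);
  triv_cover : forall x, exists i, triv_dom i x;
  trivK : forall i x, triv_dom i x -> cancel (triv i x) (@trivV i x);
  trivVK : forall i x, triv_dom i x -> cancel (@trivV i x) (triv i x);
  triv_smooth : forall i j (v : 'rV[R]_r),
    smooth_fun (triv_dom i `&` triv_dom j) (fun x => triv j x (@trivV i x v)) }.

Section Sections.
Variables (R : realType) (n : nat) (X : manifold R n) (r : nat).
Variable E : vbundle X r.

Definition smooth_section (s : forall x, E x) : Prop :=
  forall i : triv_idx E, smooth_fun (triv_dom i) (fun x => triv i x (s x)).

End Sections.

(* The bracket is a function on all sections, but is only specified on the
   smooth ones.  The map [anchor x] takes its values in T_x X. *)
Record lie_algebroid (R : realType) (n : nat) (X : manifold R n) (r : nat) :=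
  LieAlgebroid {
  lbundle :> vbundle X r;
  bracket : (forall x, lbundle x) -> (forall x, lbundle x) ->
            (forall x, lbundle x);
  anchor : forall x, {linear lbundle x -> ((X -> R) -> R)};
  anchor_tangent : forall x a, tangent x (anchor x a);
  anchor_smooth : forall (i : triv_idx lbundle) (v : 'rV[R]_r) (g : X -> R),
    smooth g ->
    smooth_fun (triv_dom i) (fun x => anchor x (@trivV _ _ _ _ lbundle i x v) g);
  bracket_smooth : forall v w, smooth_section v -> smooth_section w ->
    smooth_section (bracket v w);
  bracket_linearl : forall (a : R) u v w, smooth_section u ->
    smooth_section v -> smooth_section w -> forall x,
    bracket (fun y => a *: u y + v y) w x = a *: bracket u w x + bracket v w x;
  bracket_anticomm : forall v w, smooth_section v -> smooth_section w ->
    forall x, bracket v w x = - bracket w v x;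
  bracket_jacobi : forall u v w, smooth_section u ->
    smooth_section v -> smooth_section w -> forall x,
    bracket u (bracket v w) x + bracket v (bracket w u) x
      + bracket w (bracket u v) x = 0;
  bracket_leibniz : forall (g : X -> R) v w, smooth g ->
    smooth_section v -> smooth_section w -> forall x,
    bracket v (fun y => g y *: w y) x
      = g x *: bracket v w x + anchor x (v x) g *: w x }.

Section Forms.
Variables (R : realType) (n : nat) (X : manifold R n) (r : nat).
Variable A : lie_algebroid X r.

Definition iso_locus : set X :=
  [set x | set_bij setT (tangent x) (anchor A x)].

Definition is_form (k : nat) (w : forall x, ('I_k -> A x) -> R) : Prop :=
  [/\ forall x (v : 'I_k -> A x) (j : 'I_k) (a : R) (s t : A x),
        w x (dfwith v j (a *: s + t))
          = a * w x (dfwith v j s) + w x (dfwith v j t),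
      forall x (v : 'I_k -> A x) (i j : 'I_k), i != j -> v i = v j -> w x v = 0 &
      forall (i : triv_idx A) (v : 'I_k -> 'rV[R]_r),
        smooth_fun (triv_dom i)
          (fun x => w x (fun j => @trivV _ _ _ _ A i x (v j)))].

(* The sections [v_i, v_j], v_0, ..., v_k with v_i and v_j omitted. *)
Definition bracket_args (k : nat) (v : 'I_k.+1 -> forall x, A x)
    (i j : 'I_k.+1) : seq (forall x, A x) :=
  bracket (v i) (v j) :: [seq v l | l <- enum 'I_k.+1 & (l != i) && (l != j)].

(* The Koszul formula: the value of d_A w on the sections v_0, ..., v_k. *)
Definition koszul (k : nat) (w : forall x, ('I_k -> A x) -> R)
    (v : 'I_k.+1 -> forall x, A x) (x : X) : R :=
  \sum_(i < k.+1) (-1) ^+ i *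
     anchor A x (v i x) (fun y => w y (fun l => v (lift i l) y))
  + \sum_(i < k.+1) \sum_(j < k.+1 | (i < j)%N) (-1) ^+ (i + j) *
     w x (fun l => nth (fun y => 0) (bracket_args v i j) l x).

(* dw = d_A w *)
Definition is_dA (k : nat) (w : forall x, ('I_k -> A x) -> R)
    (dw : forall x, ('I_k.+1 -> A x) -> R) : Prop :=
  forall v : 'I_k.+1 -> forall x, A x, (forall i, smooth_section (v i)) ->
    forall x, dw x (fun i => v i x) = koszul w v x.

Definition closed_form (k : nat) (w : forall x, ('I_k -> A x) -> R) : Prop :=
  is_dA w (fun _ _ => 0).

Definition pair_vec (x : X) (a b : A x) : 'I_2 -> A x :=
  fun i => if i == 0 then a else b.

Definition nondegenerate_on (x : X) (K : set (A x))
    (w : forall x, ('I_2 -> A x) -> R) : Prop :=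
  forall a, K a -> (forall b, K b -> w x (pair_vec a b) = 0) -> a = 0.

Definition symplectic (w : forall x, ('I_2 -> A x) -> R) : Prop :=
  [/\ is_form w, closed_form w & forall x, nondegenerate_on (@setT (A x)) w].

End Forms.

Section Morphisms.
Variables (R : realType) (m p : nat) (X : manifold R m) (Y : manifold R p).
Variables (r s : nat) (A : lie_algebroid X r) (B : lie_algebroid Y s).
Variables (f : X -> Y) (phi : forall x, {linear A x -> B (f x)}).

Definition vbundle_map : Prop :=
  smooth_map f /\
  forall (i : triv_idx A) (j : triv_idx B) (v : 'rV[R]_r),
    smooth_fun (triv_dom i `&` f @^-1` triv_dom j)
      (fun x => triv j (f x) (phi x (@trivV _ _ _ _ A i x v))).

Definition pullback (k : nat) (w : forall y, ('I_k -> B y) -> R) :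
    forall x, ('I_k -> A x) -> R :=
  fun x v => w (f x) (fun i => phi x (v i)).

Definition lie_algebroid_morphism : Prop :=
  vbundle_map /\
  forall k (w : forall y, ('I_k -> B y) -> R)
           (dw : forall y, ('I_k.+1 -> B y) -> R),
    is_form w -> is_form dw -> is_dA w dw -> is_dA (pullback w) (pullback dw).

(* If the isomorphism locus of A is empty, then so is Delta, and only a Lie
   algebroid fibration is left. *)
Definition lie_algebroid_lefschetz_fibration (n : nat) : Prop :=
  [/\ r = n.*2 /\ s = 2%N,
      lie_algebroid_morphism,
      exists Delta : set X,
        [/\ Delta `<=` isolated Delta,
            Delta `<=` iso_locus A,
            f @` Delta `<=` iso_locus B &
            forall x, ~ Delta x -> set_surj setT setT (phi x)] &
      iso_locus A !=set0 ->
        lefschetz_fibration n (iso_locus A) (iso_locus B) f].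

(* The generic fibres are those over the regular values. *)
Definition connected_fibres : Prop :=
  forall y, iso_locus B y ->
    (forall x, iso_locus A x -> f x = y -> regular_point f x) ->
    connected (iso_locus A `&` f @^-1` [set y]).

End Morphisms.

(* Main.v *)
Require Import Defs.
From HB Require Import structures.
From mathcomp Require Import all_boot all_order all_algebra.
From mathcomp Require Import all_classical all_reals all_analysis.
From mathcomp Require Import complex ring lra.

Set Implicit Arguments.
Unset Strict Implicit.
Unset Printing Implicit Defensive.

Import Order.TTheory GRing.Theory Num.Theory numFieldNormedType.Exports.

Local Open Scope classical_set_scope.
Local Open Scope ring_scope.

(** Let [w] be symplectic on the base algebroid and [eta] the given closed form.
    The symplectic form is [form_comb (pullback phi w) eta K], that is,
    [K phi^* w + eta] for a constant K of large absolute value and suitable sign.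
    It is a form ([pullback_is_form], [form_comb_is_form]) and closed
    ([form_comb_closed]); nondegeneracy is a matter of its Pfaffian.  As w lives on
    a bundle of rank two, [phi^* w] has zero Pfaffian ([pullback_pfaffian]), and
      [Pf (K phi^* w + eta) = K (phi^* w /\ eta) + Pf eta].

    Where phi is surjective, [phi^* w /\ eta] is the value of eta on the kernel of
    phi and does not vanish ([wedge_pullback_neq0]), so the first term dominates
    nearby for all K of large absolute value ([regular_nondegenerate]).

    Where phi is not surjective, the anchors are isomorphisms and phi is the
    differential of f ([morphism_anchor], [chart_frame_push]), so the point is
    critical and [f = z_1 ^ 2 + z_2 ^ 2] in oriented coordinates.  There phi
    vanishes and eta is nondegenerate, but the two terms must not cancel at nearby
    points: their signs have to agree.  The fibres close to the critical point are
    complex curves, whose tangent lines approach every complex line of C^2, so by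
    continuity eta is semidefinite on all complex lines at the critical point.  This
    forces its Pfaffian to be positive for the complex orientation, whatever the
    sign of eta on the fibres ([pfaffian_ge0], [lefschetz_signs]).

    It remains to see that one sign of K makes [K (phi^* w /\ eta)] nonnegative near
    all critical points simultaneously.  The isomorphism locus is connected and
    oriented, the critical points are isolated in it, and [phi^* w /\ eta] vanishes
    only at these; since a punctured ball of dimension at least two is connected
    ([punctured_ball_sign]), its sign relative to the orientation is constant
    ([global_sign]).  Compactness of X then gives a constant K that works
    everywhere.

    Tangent vectors being derivations of the algebra of smooth functions, and
    algebroid morphisms being characterized on smooth sections, all of this rests on
    the existence of bump functions ([bump_in_chart], [section_through]).  With
    these, the frame of the algebroid that the anchor maps to the coordinate vectors
    of a chart is shown to be continuous ([chart_frame_matrix]). *)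

(* The same name is also used for the coordinates in a basis of a vector space. *)
Local Notation coord := Defs.coord.

(** * Calculus of the classes C^k *)

Section SmoothCalculus.
Variable R : realType.
Implicit Types V W : normedModType R.

(** This allows one to replace a function by a formula for it that is only valid on
    an open set. *)
Lemma near_eq_differentiable V W (f g : V -> W) (x : V) :
  {near x, f =1 g} -> differentiable f x -> differentiable g x.
Proof.
move=> fg df; have [dc fE] := (diff_locallyP x f).1 df.
have fgx : f x = g x by exact: nbhs_singleton fg.
suff gE : g \o shift x = cst (g x) + 'd f x +o_ 0 id.
  by apply/diff_locallyP; rewrite (diff_unique dc gE).
apply/eqaddoP => e e0; move/eqaddoP : fE => /(_ e e0) fE.
near=> h.
suff -> : (g \o shift x - (cst (g x) + 'd f x)) h =
          (f \o shift x - (cst (f x) + 'd f x)) h by near: h.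
rewrite /= !fctE /= -fgx; congr (_ - _); symmetry.
near: h; have : {near (0 + x), f =1 g} by rewrite add0r.
by rewrite (near_shift 0 (0 + x)) subr0 add0r; apply: filterS => h /=; rewrite addrC.
Unshelve. all: by end_near. Qed.

Lemma Ck_sub V W k (O O' : set V) (f : V -> W) :
  O' `<=` O -> Ck k O f -> Ck k O' f.
Proof.
elim: k f => [|k IH] f sO /= => [h x /sO/h //|[h1 h2]]; split=> [x /sO/h1 //|v].
exact: IH.
Qed.

Lemma Ck_ext V W k (O : set V) (f g : V -> W) :
  open O -> (forall x, O x -> f x = g x) -> Ck k O f -> Ck k O g.
Proof.
move=> oO; elim: k f g => [|k IH] f g fg /=.
  move=> fc x Ox; have fgx : {near x, f =1 g}.
    by apply: filterS (open_nbhs_nbhs (conj oO Ox)).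
  rewrite /prop_for /continuous_at -(fg _ Ox).
  by apply: cvg_trans (fc x Ox); apply: near_eq_cvg fgx.
move=> [f1 f2]; split=> [x Ox|v].
  apply: near_eq_differentiable (f1 x Ox).
  by apply: filterS (open_nbhs_nbhs (conj oO Ox)).
apply: IH (f2 v) => x Ox; apply: near_eq_derive.
by apply: filterS (open_nbhs_nbhs (conj oO Ox)).
Qed.

Lemma Ck_local V W k (O : set V) (f : V -> W) :
  (forall x, O x -> exists O', O' x /\ Ck k O' f) -> Ck k O f.
Proof.
elim: k f => [|k IH] f h /=.
  by move=> x /h[U [Ux /(_ x)]]; exact.
split=> [x /h[U [Ux [h1 _]]]|v]; first exact: h1.
by apply: IH => x /h[U [Ux [_ h2]]]; exists U; split => //; exact: h2.
Qed.

(** Being C^(k+1) does not contain being C^k by definition: at the bottom of the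
    recursion, continuity comes from differentiability. *)
Lemma Ck_pred V W k (O : set V) (f : V -> W) : Ck k.+1 O f -> Ck k O f.
Proof.
elim: k f => [|k IH] f /= [h1 h2].
  by move=> x Ox; exact: differentiable_continuous (h1 x Ox).
by split=> // v; exact: IH.
Qed.

Lemma Ck_cst V W k (O : set V) (a : W) : open O -> Ck k O (fun=> a).
Proof.
move=> oO; elim: k a => [|k IH] a /=; first by move=> x _; exact: cst_continuous.
split=> [x _|v]; first exact: differentiable_cst.
by apply: (@Ck_ext _ _ _ _ (fun=> 0)) => // x _; rewrite derive_cst.
Qed.

Lemma CkD V W k (O : set V) (f g : V -> W) : open O ->
  Ck k O f -> Ck k O g -> Ck k O (fun x => f x + g x).
Proof.
move=> oO; elim: k f g => [|k IH] f g /=.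
  by move=> fc gc x Ox; apply: cvgD; [exact: fc|exact: gc].
move=> [f1 f2] [g1 g2]; split=> [x Ox|v]; first exact: differentiableD (f1 x Ox) (g1 x Ox).
apply: Ck_ext (IH _ _ (f2 v) (g2 v)) => // x Ox.
by rewrite deriveD//; apply/diff_derivable; [exact: f1|exact: g1].
Qed.

Lemma CkM V k (O : set V) (f g : V -> R) : open O ->
  Ck k O f -> Ck k O g -> Ck k O (fun x => f x * g x).
Proof.
move=> oO; elim: k f g => [|k IH] f g.
  by move=> fc gc x Ox; apply: cvgM; [exact: fc|exact: gc].
move=> fk gk; have [f1 f2] := fk; have [g1 g2] := gk.
split=> [x Ox|v]; first exact: differentiableM (f1 x Ox) (g1 x Ox).
have := CkD oO (IH _ _ (Ck_pred fk) (g2 v)) (IH _ _ (Ck_pred gk) (f2 v)).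
apply: Ck_ext => // x Ox.
by rewrite deriveM//; apply/diff_derivable; [exact: f1|exact: g1].
Qed.

Lemma Ck_sum V W k (O : set V) n (f : 'I_n -> V -> W) : open O ->
  (forall i, Ck k O (f i)) -> Ck k O (fun x => \sum_(i < n) f i x).
Proof.
move=> oO fk; elim: n f fk => [|n IH] f fk.
  apply: Ck_ext (Ck_cst k 0 oO) => // x _; by rewrite big_ord0.
apply: Ck_ext (CkD oO (IH _ (fun i => fk (widen_ord (leqnSn n) i))) (fk ord_max)) => //.
by move=> x _; rewrite big_ord_recr.
Qed.

Lemma is_derive_coord n (u v : 'rV[R]_n) i :
  is_derive u v (fun u : 'rV[R]_n => u 0 i : R) (v 0 i).
Proof.
apply: DeriveDef; first exact: diff_derivable (differentiable_coord _ _ _).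
have := derive_mx (@derivable_id _ _ u v); rewrite derive_id => /matrixP/(_ 0 i).
by rewrite mxE => <-.
Qed.

Lemma Ck_coord n k (O : set 'rV[R]_n) i : open O ->
  Ck k O (fun u : 'rV[R]_n => u 0 i : R).
Proof.
move=> oO; case: k => [|k] /=; first by move=> x _; exact: coord_continuous.
split=> [x _|v]; first exact: differentiable_coord.
have -> : 'D_v (fun u : 'rV[R]_n => u 0 i : R) = fun=> v 0 i.
  by apply/funext => u; have [_ ->] := is_derive_coord u v i.
exact: Ck_cst.
Qed.

Lemma CkZl V W k (O : set V) (f : V -> R) (w : W) : open O ->
  Ck k O f -> Ck k O (fun x => f x *: w).
Proof.
move=> oO; elim: k f => [|k IH] f.
  by move=> fc x Ox; apply: cvgZr_tmp; exact: fc.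
move=> [f1 f2]; split=> [x Ox|v]; first exact: differentiableZl (f1 x Ox).
apply: Ck_ext (IH _ (f2 v)) => // x Ox.
rewrite !deriveE; [by rewrite diffZl//; exact: f1| |exact: f1].
exact: differentiableZl (f1 x Ox).
Qed.

Lemma Ck_rV V n k (O : set V) (f : V -> 'rV[R]_n) : open O ->
  Ck k O f <-> forall i, Ck k O (fun x => f x 0 i : R).
Proof.
move=> oO; split; last first.
  move=> h; have hs := Ck_sum oO (fun i : 'I_n => CkZl (delta_mx 0 i : 'rV[R]_n) oO (h i)).
  apply: Ck_ext hs => //.
  by move=> x _; rewrite [RHS]row_sum_delta.
elim: k f => [|k IH] f.
  move=> fc i x Ox; apply: (@continuous_comp _ _ _ f (fun u : 'rV[R]_n => u 0 i : R)).
    exact: fc.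
  exact: coord_continuous.
move=> [f1 f2] i; split=> [x Ox|v].
  apply: (@differentiable_comp _ _ _ _ f (fun u : 'rV[R]_n => u 0 i : R)).
    exact: f1.
  exact: differentiable_coord.
apply: Ck_ext (IH _ (f2 v) i) => // x Ox.
by rewrite derive_mx ?mxE//; apply/diff_derivable; exact: f1.
Qed.

Lemma derive_sumE n W (g : 'rV[R]_n -> W) u v : differentiable g u ->
  'D_v g u = \sum_i v 0 i *: 'D_(delta_mx 0 i) g u.
Proof.
move=> dg; rewrite deriveE// {1}[v]row_sum_delta linear_sum.
by apply: eq_bigr => i _; rewrite linearZ deriveE.
Qed.

(** The chain rule in coordinates: the partial derivatives of g are again of the
    kind to which the induction in [smooth_on_comp] applies. *)
Lemma derive_chain V n W (f : V -> 'rV[R]_n) (g : 'rV[R]_n -> W) x v :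
  differentiable f x -> differentiable g (f x) ->
  'D_v (g \o f) x = \sum_i ('D_v f x) 0 i *: 'D_(delta_mx 0 i) g (f x).
Proof.
move=> df dg; rewrite -derive_sumE// !deriveE//; last exact: differentiable_comp.
by rewrite diff_comp.
Qed.

Lemma smooth_on_comp V n (O : set V) (O' : set 'rV[R]_n)
    (f : V -> 'rV[R]_n) (g : 'rV[R]_n -> R) :
  open O -> f @` O `<=` O' -> smooth_on O f -> smooth_on O' g ->
  smooth_on O (g \o f).
Proof.
move=> oO fO fs gs k; elim: k g gs => [|k IH] g gs /=.
  move=> x Ox; apply: continuous_comp; first exact: (fs 0%N).
  by apply: (gs 0%N); apply: fO; exists x.
have df x : O x -> differentiable f x by case: (fs 1%N) => h _ /h.
have dg x : O x -> differentiable g (f x).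
  by move=> Ox; case: (gs 1%N) => h _; apply: h; apply: fO; exists x.
split=> [x Ox|v]; first by apply: differentiable_comp; [exact: df|exact: dg].
pose h i x := ('D_v f x) 0 i * 'D_(delta_mx 0 i) g (f x).
have hk i : Ck k O (h i).
  apply: CkM => //; last first.
    by apply: (IH ('D_(delta_mx 0 i) g)) => l; case: (gs l.+1) => _; exact.
  move: i; apply/(Ck_rV k _ oO); case: (fs k.+1) => _; exact.
have hs := Ck_sum oO hk.
have := Ck_ext oO _ hs; apply => // x Ox.
by rewrite derive_chain; [|exact: df|exact: dg].
Qed.

End SmoothCalculus.

(** * A smooth function that is flat at the origin *)

Section Flat.
Variable R : realType.

(** The functions [t ^- n * exp (- 1 / t)], extended by 0 to [t <= 0]: their
    derivatives are linear combinations of functions of the same family, which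
    makes them smooth by induction on the order. *)
Definition flat (n : nat) (t : R) : R :=
  if 0 < t then t^-1 ^+ n * expR (- t^-1) else 0.

(** The exponential series gives [s ^ (n + 2) / (n + 2)! <= exp s] for [s = 1 / t];
    a quadratic bound makes the derivative at 0 vanish. *)
Lemma flat_le n (t : R) : `|flat n t| <= (n.+2)`!%:R * t ^+ 2.
Proof.
rewrite /flat; case: ifPn => [t0|_]; last first.
  by rewrite normr0 mulr_ge0// sqr_ge0.
move: (t^-1) (invrK t) t0 => s <-; rewrite invr_gt0 => s0.
have sn0 : 0 <= s ^+ n * expR (- s).
  by rewrite mulr_ge0 ?expR_ge0// exprn_ge0// ltW.
rewrite ger0_norm//.
have /(_ (ltW s0)) h := @expR_ge1Dxn R s n.+1.
have f0 : (0 : R) < (n.+2)`!%:R by rewrite ltr0n fact_gt0.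
have : s ^+ n.+2 / (n.+2)`!%:R <= expR s by apply: le_trans h; rewrite lerDr.
rewrite ler_pdivrMr// expRN exprVn ler_pdivlMr ?exprn_gt0// mulrAC -exprD addn2.
by rewrite ler_pdivrMr ?expR_gt0// mulrC.
Qed.

Lemma is_derive_flat n (t : R) :
  is_derive t 1 (flat n) (flat n.+2 t - n%:R * flat n.+1 t).
Proof.
have [t0|t0|->] := ltgtP t 0.
- have E : flat n.+2 t - n%:R * flat n.+1 t = 0.
    by rewrite /flat !ltNge (ltW t0)/= mulr0 subrr.
  rewrite E; apply: near_eq_is_derive (is_derive_cst (0 : R) t (1 : R)).
  near=> u; rewrite /flat ltNge ltW//=; near: u.
  by apply: open_nbhs_nbhs; split=> //; exact: open_lt.
- have tn0 : t != 0 by rewrite gt_eqF.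
  have dV : is_derive t (1 : R) (fun u : R => u^-1) (- t ^- 2).
    apply: DeriveDef; first by apply: derivableV.
    by rewrite deriveV// derive_id /GRing.scale/= mulr1.
  have dX : is_derive t (1 : R) (fun u : R => u^-1 ^+ n)
      ((n%:R * t^-1 ^+ n.-1) *: (- t ^- 2)).
    by have := @is_deriveX _ _ _ n t 1 _ dV; rewrite exprfctE.
  have dE : is_derive t (1 : R) (fun u : R => expR (- u^-1))
      (expR (- t^-1) * t ^- 2).
    have dN := is_deriveN dV.
    have := @is_derive1_comp _ expR (- (fun u : R => u^-1)) t _ _ (is_derive_expR _) dN.
    by rewrite /= opprK opprfctE.
  have := is_deriveM dX dE; rewrite mulrfctE => dM.
  have fE : \near t, t^-1 ^+ n * expR (- t^-1) = flat n t.
    near=> u; rewrite /flat; suff -> : 0 < u by [].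
    by near: u; apply: open_nbhs_nbhs; split=> //; exact: open_gt.
  apply: is_derive_eq (near_eq_is_derive fE dM) _.
  rewrite /flat t0 /GRing.scale/=.
  case: n {dX dM fE} => [|n]/=; first by rewrite !mul0r expr0 -exprVn; ring.
  by rewrite -exprVn !exprS; ring.
- have E : flat n.+2 0 - n%:R * flat n.+1 0 = 0 by rewrite /flat ltxx mulr0 subrr.
  rewrite E.
  have f0 : (0 : R) < (n.+2)`!%:R by rewrite ltr0n fact_gt0.
  have L : (fun h : R => h^-1 *: (flat n (h *: 1 + 0) - flat n 0)) @ 0^' --> (0 : R).
    apply/cvgr0Pnorm_lt => e e0; near=> h.
    have h0 : h != 0 by near: h; exact: nbhs_dnbhs_neq.
    have -> : flat n 0 = 0 by rewrite /flat ltxx.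
    rewrite subr0 addr0 /GRing.scale/= mulr1 normrM normfV.
    rewrite mulrC ltr_pdivrMr ?normr_gt0//.
    apply: le_lt_trans (flat_le n h) _.
    rewrite -[h ^+ 2]real_normK ?num_real// expr2 mulrA ltr_pM2r ?normr_gt0//.
    rewrite mulrC -ltr_pdivlMr//.
    by near: h; apply: dnbhs0_lt; rewrite divr_gt0.
  by apply: DeriveDef; [apply/cvg_ex; exists 0|exact: cvg_lim L].
Unshelve. all: by end_near. Qed.

Lemma smooth_on_flat (V : normedModType R) (O : set V) (rho : V -> R) :
  open O -> smooth_on O rho -> smooth_on O (flat 0 \o rho).
Proof.
move=> oO rs; suff flat_Ck k n : Ck k O (flat n \o rho) by move=> k; exact: flat_Ck.
elim: k n => [|k IH] n.
  move=> x Ox; apply: continuous_comp; first exact: (rs 0%N).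
  apply/differentiable_continuous/derivable1_diffP.
  by case: (is_derive_flat n (rho x)).
have df x : O x -> differentiable rho x by case: (rs 1%N) => h _ /h.
have dg t : differentiable (flat n) t.
  by apply/derivable1_diffP; case: (is_derive_flat n t).
split=> [x Ox|v]; first by apply: differentiable_comp; [exact: df|exact: dg].
have h : Ck k O (fun x => ((flat n.+2 \o rho) x + (- n%:R) * (flat n.+1 \o rho) x)
                          * 'D_v rho x).
  apply: CkM => //; last by case: (rs k.+1) => _; exact.
  apply: CkD => //.
  by apply: CkM => //; exact: Ck_cst.
apply: Ck_ext oO _ h => x Ox.
rewrite [RHS]deriveE; last by apply: differentiable_comp; [exact: df|exact: dg].
rewrite diff_comp; [|exact: df|exact: dg].
rewrite deriveE; last exact: df.
rewrite /= -[X in _ = 'd (flat n) _ X]mulr1 [RHS]linearZ /= -(deriveE _ (dg (rho x))).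
by rewrite (@derive_val _ _ _ _ _ _ _ (is_derive_flat n (rho x))) mulrC mulNr.
Qed.

End Flat.

(** * Smooth functions on manifolds *)

Section SmoothOn.
Variable R : realType.
Implicit Types V W : normedModType R.

Lemma smooth_on_sub V W (O O' : set V) (f : V -> W) :
  O' `<=` O -> smooth_on O f -> smooth_on O' f.
Proof. by move=> sO fs k; exact: Ck_sub sO (fs k). Qed.

Lemma smooth_on_ext V W (O : set V) (f g : V -> W) :
  open O -> (forall x, O x -> f x = g x) -> smooth_on O f -> smooth_on O g.
Proof. by move=> oO fg fs k; exact: Ck_ext oO fg (fs k). Qed.

Lemma smooth_on_local V W (O : set V) (f : V -> W) :
  (forall x, O x -> exists O', O' x /\ smooth_on O' f) -> smooth_on O f.
Proof.
move=> h k; apply: Ck_local => x /h[P [Px fs]].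
by exists P; split => //; exact: fs.
Qed.

Lemma smooth_on_differentiable V W (O : set V) (f : V -> W) x :
  smooth_on O f -> O x -> differentiable f x.
Proof. by move=> /(_ 1%N)[+ _] => /(_ x). Qed.

End SmoothOn.

Section Charts.
Variables (R : realType) (n : nat) (T : topologicalType).
Implicit Types c d : chart R n T.

Lemma coordK c u : is_chart c -> cimg c u -> coord c (coordV c u) = u.
Proof. by case=> _ cK _ _ [x cx <-]; rewrite cK. Qed.

Lemma coordV_dom c u : is_chart c -> cimg c u -> cdom c (coordV c u).
Proof. by case=> _ cK _ _ [x cx <-]; rewrite cK. Qed.

Lemma open_coord c (U : set T) : is_chart c -> open U ->
  open (coord c @` (U `&` cdom c)).
Proof.
move=> hc oU; have [[od oi] cK _ cVc] := hc; rewrite openE => _ [x [Ux cx] <-].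
have ix : cimg c (coord c x) by exists x.
have N1 : \forall u \near coord c x, (U `&` cdom c) (coordV c u).
  apply: (cVc _ ix); rewrite (cK _ cx).
  by apply: open_nbhs_nbhs; split; [exact: openI|split].
have N2 : \forall u \near coord c x, cimg c u by exact: open_nbhs_nbhs.
near=> u; exists (coordV c u); first by near: u.
by apply: coordK => //; near: u.
Unshelve. all: by end_near. Qed.

Lemma near_coordV c x (P : set T) : is_chart c -> cdom c x -> nbhs x P ->
  \forall u \near coord c x, P (coordV c u).
Proof.
move=> hc cx Px; have [_ cK _ cVc] := hc.
by apply: cVc; [exists x|rewrite cK].
Qed.

Lemma near_cimg c x : is_chart c -> cdom c x ->
  \forall u \near coord c x, cimg c u.
Proof. by move=> [[_ oi] _ _ _] cx; apply: open_nbhs_nbhs; split=> //; exists x. Qed.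

Lemma near_cdom c x : is_chart c -> cdom c x -> \forall y \near x, cdom c y.
Proof. by move=> [[od _] _ _ _] cx; exact: open_nbhs_nbhs. Qed.

End Charts.

Section SmoothFunctions.
Variables (R : realType) (n : nat) (X : manifold R n).
Implicit Types (W : normedModType R) (U : set X).

Lemma atlas_smooth_chart (c : chart R n X) : atlas c -> smooth_chart c.
Proof. by move=> ac; split=> [|d ad]; [exact: atlas_chart|exact: atlas_compatible]. Qed.

Lemma smooth_fun_sub W U U' (g : X -> W) : U' `<=` U -> smooth_fun U g -> smooth_fun U' g.
Proof.
move=> sU gs c ac; apply: smooth_on_sub (gs c ac).
by move=> _ [x [/sU Ux cx] <-]; exists x.
Qed.

Lemma smooth_fun_local W U (g : X -> W) :
  (forall x, U x -> exists U', U' x /\ smooth_fun U' g) -> smooth_fun U g.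
Proof.
move=> h c ac; apply: smooth_on_local => _ [x [/h[P [Px gs]] cx] <-].
by exists (coord c @` (P `&` cdom c)); split; [exists x|exact: gs].
Qed.

Lemma smooth_fun_ext W U (g h : X -> W) : open U ->
  (forall x, U x -> g x = h x) -> smooth_fun U g -> smooth_fun U h.
Proof.
move=> oU gh gs c ac; have hc := atlas_chart ac.
apply: smooth_on_ext (gs c ac); first exact: open_coord.
by case: hc => _ cK _ _ _ [x [Ux cx] <-] /=; rewrite cK//; exact: gh.
Qed.

Lemma smooth_fun_cst W U (a : W) : open U -> smooth_fun U (fun=> a).
Proof.
by move=> oU c ac k; apply: Ck_cst; apply: open_coord => //; exact: atlas_chart.
Qed.

Lemma smooth_funD W U (g h : X -> W) : open U ->
  smooth_fun U g -> smooth_fun U h -> smooth_fun U (fun x => g x + h x).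
Proof.
move=> oU gs hs c ac k; have oO := open_coord (atlas_chart ac) oU.
exact: CkD oO (gs c ac k) (hs c ac k).
Qed.

Lemma smooth_funM U (g h : X -> R) : open U ->
  smooth_fun U g -> smooth_fun U h -> smooth_fun U (fun x => g x * h x).
Proof.
move=> oU gs hs c ac k; have oO := open_coord (atlas_chart ac) oU.
exact: CkM oO (gs c ac k) (hs c ac k).
Qed.

Lemma smooth_fun_sum U p (g : 'I_p -> X -> R) : open U ->
  (forall i, smooth_fun U (g i)) -> smooth_fun U (fun x => \sum_i g i x).
Proof.
move=> oU gs c ac k; have oO := open_coord (atlas_chart ac) oU.
exact: Ck_sum oO (fun i => gs i c ac k).
Qed.

Lemma smooth_fun_rV U p (g : X -> 'rV[R]_p) : open U ->
  smooth_fun U g <-> forall i, smooth_fun U (fun x => g x 0 i : R).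
Proof.
move=> oU; split=> [gs i c ac k|gs c ac k];
  have oO := open_coord (atlas_chart ac) oU.
  by move: i; apply/(Ck_rV k _ oO); exact: gs.
by apply/(Ck_rV k _ oO) => i; exact: gs.
Qed.

Lemma smooth_fun_continuous W U (g : X -> W) x : open U -> U x ->
  smooth_fun U g -> {for x, continuous g}.
Proof.
move=> oU Ux gs; have [c ac cx] := @atlas_cover _ _ X x.
have [_ cK cc _] := atlas_chart ac.
have gc : {for coord c x, continuous (g \o coordV c)}.
  by apply: (gs c ac 0%N); exists x.
have hc : {for x, continuous ((g \o coordV c) \o coord c)}.
  exact: (continuous_comp (cc _ cx) gc).
apply: cvg_trans (_ : ((g \o coordV c) \o coord c) @ x --> g x).
  apply: near_eq_cvg; apply: filterS (near_cdom (atlas_chart ac) cx) => y cy /=.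
  by rewrite cK.
by have := hc; rewrite /prop_for /continuous_at /= (cK _ cx).
Qed.

Lemma smooth_fun_chart U (g : X -> R) c : open U -> smooth_chart c ->
  smooth_fun U g -> smooth_on (coord c @` (U `&` cdom c)) (g \o coordV c).
Proof.
move=> oU [hc cc] gs; apply: smooth_on_local => _ [x [Ux cx] <-].
have [d ad dx] := @atlas_cover _ _ X x; have hd := atlas_chart ad.
have [_ cK _ _] := hc; have [[od _] dK _ _] := hd.
pose O := coord c @` ((U `&` cdom d) `&` cdom c).
have oO : open O by apply: open_coord => //; exact: openI.
exists O; split; first by exists x.
apply: (@smooth_on_ext _ _ _ _ ((g \o coordV d) \o transition c d)) => //.
  by move=> _ [y [[Uy dy] cy] <-]; rewrite /transition /= cK// dK.
apply: smooth_on_comp oO _ _ (gs d ad).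
  by move=> _ [_ [y [[Uy dy] cy] <-] <-]; exists y; rewrite // /transition /= cK.
apply: smooth_on_sub (proj1 (cc d ad)).
by move=> _ [y [[Uy dy] cy] <-]; exists y.
Qed.

Lemma smooth_diff (g : X -> R) c x : smooth g -> smooth_chart c -> cdom c x ->
  differentiable (g \o coordV c) (coord c x).
Proof.
move=> gs hc cx; apply: smooth_on_differentiable (smooth_fun_chart openT hc gs) _.
by exists x.
Qed.

(** Smoothness is local, and the extension by 0 is smooth both on the chart and on
    the complement of K; these cover X because K is closed in X and not merely
    in the chart. *)
Lemma smooth_extension c (K : set X) (G : 'rV[R]_n -> R) :
  smooth_chart c -> smooth_on (cimg c) G -> closed K -> K `<=` cdom c ->
  (forall y, cdom c y -> ~ K y -> G (coord c y) = 0) ->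
  smooth (fun y => if pselect (cdom c y) then G (coord c y) else 0).
Proof.
move=> [hc cc] Gs Kc KU G0; set g := (fun y => _).
have [[odc _] cK _ _] := hc.
apply: smooth_fun_local => x _; have [cx|ncx] := pselect (cdom c x).
  exists (cdom c); split=> // d ad; have hd := atlas_chart ad.
  have [_ dK _ _] := hd.
  apply: (@smooth_on_ext _ _ _ _ (G \o transition d c)).
  - exact: open_coord.
  - move=> _ [y [cy dy] <-]; rewrite /transition /= dK// /g.
    by case: pselect.
  - apply: smooth_on_comp (open_coord hd odc) _ _ Gs.
      by move=> _ [_ [y [cy dy] <-] <-]; exists y; rewrite // /transition /= dK.
    by have := proj2 (cc d ad); rewrite setIC.
exists (~` K); split; first by move=> /KU.
apply: (@smooth_fun_ext _ _ (fun=> 0)); first exact: closed_openC.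
  by move=> y nKy; rewrite /g; case: pselect => // cy; rewrite G0.
by apply: smooth_fun_cst; exact: closed_openC.
Qed.

(** K is the image of a closed ball, hence compact, hence closed in X since X is
    Hausdorff. *)
Lemma bump_in_chart c x (U : set X) : smooth_chart c -> cdom c x ->
  open U -> U x ->
  exists (chi : 'rV[R]_n -> R) (K : set X),
    [/\ smooth_on setT chi, 0 < chi (coord c x), closed K, K `<=` cdom c `&` U &
        forall y, cdom c y -> ~ K y -> chi (coord c y) = 0].
Proof.
move=> [hc _] cx oU Ux; have [_ cK _ cVc] := hc.
set u0 := coord c x.
have /nbhs_ballP[e /= e0 be] : nbhs u0 (coord c @` (U `&` cdom c)).
  by apply: open_nbhs_nbhs; split; [exact: open_coord|exists x].
(* Half of the radius, so that the closed ball stays in the image of the chart. *)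
pose r := e / 2; have r0 : 0 < r by rewrite divr_gt0.
pose B := [set u : 'rV[R]_n | `|u - u0| <= r].
have BO u : B u -> (coord c @` (U `&` cdom c)) u.
  move=> Bu; apply: be; rewrite -ball_normE /= distrC (le_lt_trans Bu)//.
  by rewrite /r ltr_pdivrMr// ltr_pMr// ltr1n.
have Bc : compact B.
  apply: bounded_closed_compact.
    exists (r + `|u0|); split; first exact: num_real.
    move=> M hM u Bu; apply: le_trans (ltW hM); rewrite -[u](subrK u0).
    by apply: le_trans (ler_normD _ _) _; rewrite lerD2r.
  have -> : B = closed_ball u0 r.
    by rewrite closed_ballE//; apply/seteqP; split=> u; rewrite /B /closed_ball_ /= distrC.
  exact: closed_ball_closed.
pose rho (u : 'rV[R]_n) := r ^+ 2 + (-1) * \sum_i (u 0 i + - u0 0 i) * (u 0 i + - u0 0 i).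
have rhos : smooth_on setT rho.
  move=> k; have oT := @openT 'rV[R]_n.
  apply: CkD => //; first exact: Ck_cst.
  apply: CkM => //; first exact: Ck_cst.
  apply: Ck_sum => // i.
  by apply: CkM => //; apply: CkD => //; try exact: Ck_cst; exact: Ck_coord.
exists (flat 0 \o rho), (coordV c @` B); split.
- exact: smooth_on_flat openT rhos.
- rewrite /=; have -> : rho (coord c x) = r ^+ 2.
    by rewrite /rho big1 ?mulr0 ?addr0// => i _; rewrite subrr mul0r.
  by rewrite /flat exprn_gt0// mul1r expR_gt0.
- apply: compact_closed; first exact: mhausdorff.
  apply: continuous_compact Bc; apply: continuous_in_subspaceT => u.
  rewrite inE => /BO[y [_ cy] <-]; apply: cVc; by exists y.
- by move=> _ [u /BO[y [Uy cy] <-] <-]; rewrite cK.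
- move=> y cy nK; rewrite /= /flat; case: ifPn => // rho0; exfalso; apply: nK.
  exists (coord c y); last by rewrite cK.
  rewrite /B /= /Num.norm /= mx_normrE; apply: bigmax_le => [|[i j] _]; first exact: ltW.
  have r0' := ltW r0.
  rewrite ord1 !mxE /= -(@ler_pXn2r _ 2)// ?nnegrE// real_normK ?num_real//.
  move: rho0; rewrite /rho mulN1r subr_gt0 => rho0; apply: le_trans (ltW rho0).
  rewrite (bigD1 j)//= expr2 lerDl; apply: sumr_ge0 => k _.
  by rewrite -expr2 sqr_ge0.
Qed.

Lemma bump_function x (U : set X) : open U -> U x ->
  exists (chi : X -> R) (K : set X),
    [/\ smooth chi, 0 < chi x, closed K, K `<=` U & forall y, ~ K y -> chi y = 0].
Proof.
move=> oU Ux; have [c ac cx] := @atlas_cover _ _ X x.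
have [h [K [hs h0 Kc KU hK]]] := bump_in_chart (atlas_smooth_chart ac) cx oU Ux.
exists (fun y => if pselect (cdom c y) then h (coord c y) else 0), K.
split=> //; last 2 first.
- by move=> y /KU[].
- by move=> y nK; case: pselect => // cy; exact: hK.
- apply: smooth_extension (atlas_smooth_chart ac) _ Kc _ hK.
    exact: smooth_on_sub hs.
  by move=> y /KU[].
- by case: pselect.
Qed.

(** Tangent vectors only act on functions defined on all of X, so the coordinates
    of a chart have to be multiplied by a bump function h.  They vanish at x, so
    their partial derivatives at x are those of the coordinates up to the factor
    [h (coord c x)]. *)
Lemma cutoff_coordinates c x : smooth_chart c -> cdom c x ->
  exists (h : 'rV[R]_n -> R) (g : 'I_n -> X -> R),
    [/\ smooth_on setT h, 0 < h (coord c x), forall k, smooth (g k) &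
        forall k u, cimg c u ->
          g k (coordV c u) = (u 0 k + - coord c x 0 k) * h u].
Proof.
move=> hc cx; have [h [K [hs h0 Kc KU hK]]] := bump_in_chart hc cx openT I.
exists h, (fun k y => if pselect (cdom c y) then
  (coord c y 0 k + - coord c x 0 k) * h (coord c y) else 0); split=> // [k|k u iu].
  apply: (@smooth_extension c K (fun u => (u 0 k + - coord c x 0 k) * h u)) => //.
  - apply: smooth_on_sub (_ : smooth_on setT _) => // l.
    apply: CkM; [exact: openT| |exact: hs].
    apply: CkD; [exact: openT|exact: (Ck_coord _ _ openT)|exact: (Ck_cst _ _ openT)].
  - by move=> y /KU[].
  - by move=> y cy nK; rewrite hK// mulr0.
have [hc1 _] := hc; have cu := coordV_dom hc1 iu.
by case: pselect => //= a; rewrite coordK.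
Qed.

End SmoothFunctions.

(** * Coordinate vectors and sections *)

Section CoordinateVectors.
Variables (R : realType) (n : nat) (X : manifold R n).

Lemma smooth_lin (a : R) (g h : X -> R) : smooth g -> smooth h ->
  smooth (fun y => a * g y + h y).
Proof.
move=> gs hs; apply: smooth_funD; [exact: openT| |exact: hs].
by apply: smooth_funM; [exact: openT|apply: smooth_fun_cst; exact: openT|exact: gs].
Qed.

Lemma smoothM (g h : X -> R) : smooth g -> smooth h -> smooth (fun y => g y * h y).
Proof. by move=> gs hs; apply: smooth_funM; [exact: openT| |]. Qed.

(** The value 0 on non-smooth functions is the one that [tangent] prescribes. *)
Definition chart_vector (c : chart R n X) (x : X) (v : 'rV[R]_n) : (X -> R) -> R :=
  fun g => if pselect (smooth g) then 'D_v (g \o coordV c) (coord c x) else 0.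

Lemma chart_vectorE c x v (g : X -> R) : smooth g ->
  chart_vector c x v g = 'D_v (g \o coordV c) (coord c x).
Proof. by move=> gs; rewrite /chart_vector; case: pselect. Qed.

Lemma tangent_chart_vector c x v : smooth_chart c -> cdom c x ->
  tangent x (chart_vector c x v).
Proof.
move=> hc cx; have [[_ cK _ _] _] := hc; split=> [a g h gs hs|g h gs hs|g ngs].
- have dg := smooth_diff gs hc cx; have dh := smooth_diff hs hc cx.
  rewrite !chart_vectorE//; last exact: smooth_lin.
  have -> : (fun y => a * g y + h y) \o coordV c =
      (a *: (g \o coordV c) + (h \o coordV c)) by apply/funext.
  rewrite deriveD; [|by apply: derivableZ; exact: diff_derivable|exact: diff_derivable].
  by rewrite deriveZ//; exact: diff_derivable.
- have dg := smooth_diff gs hc cx; have dh := smooth_diff hs hc cx.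
  rewrite !chart_vectorE//; last exact: smoothM.
  have -> : (fun y => g y * h y) \o coordV c =
      (g \o coordV c) * (h \o coordV c) by apply/funext.
  rewrite deriveM; [|exact: diff_derivable|exact: diff_derivable].
  rewrite /= cK// addrC; congr (_ + _); exact: mulrC.
- by rewrite /chart_vector; case: pselect.
Qed.

End CoordinateVectors.

Section Maps.
Variables (R : realType) (m p : nat) (X : manifold R m) (Y : manifold R p).
Variable f : X -> Y.

(** The charts c and d need not be in the atlases, so one passes through charts
    that are. *)
Lemma smooth_map_chart (c : chart R m X) (d : chart R p Y) (x : X) :
  smooth_map f -> smooth_chart c -> smooth_chart d -> cdom c x -> cdom d (f x) ->
  differentiable (coord d \o f \o coordV c) (coord c x).
Proof.
move=> [fc fs] [hc cc] [hd dd] cx dx.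
have [c' ac' cx'] := @atlas_cover _ _ X x.
have [d' ad' dx'] := @atlas_cover _ _ Y (f x).
have hc' := atlas_chart ac'; have hd' := atlas_chart ad'.
have [[oc _] cK _ _] := hc; have [[oc' _] cK' _ _] := hc'.
have [[od _] dK _ _] := hd; have [[od' _] dK' _ _] := hd'.
apply: (@near_eq_differentiable _ _ _
    (transition d' d \o (coord d' \o f \o coordV c') \o transition c c')).
  have /(near_coordV hc cx) : nbhs x (cdom c `&` cdom c' `&`
      f @^-1` (cdom d `&` cdom d')).
    apply: open_nbhs_nbhs; split; last by split.
    apply: openI; first exact: openI.
    by apply: open_comp; [move=> ? _; exact: fc|exact: openI].
  apply: filterS => u [[cu cu'] [du du']].
  by rewrite /transition /= cK'// dK'.
have dt : differentiable (transition c c') (coord c x).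
  by apply: smooth_on_differentiable (proj1 (cc _ ac')) _; exists x.
have E : transition c c' (coord c x) = coord c' x by rewrite /transition /= cK.
have df : differentiable (coord d' \o f \o coordV c') (coord c' x).
  by apply: smooth_on_differentiable (fs _ _ ac' ad') _; exists x.
have dt' : differentiable (transition d' d) (coord d' (f x)).
  by apply: smooth_on_differentiable (proj2 (dd _ ad')) _; exists (f x).
apply: differentiable_comp => //; rewrite E.
by apply: differentiable_comp => //; rewrite /= cK'.
Qed.

Lemma smooth_fun_comp (U : set Y) (g : Y -> R) : smooth_map f -> open U ->
  smooth_fun U g -> smooth_fun (f @^-1` U) (g \o f).
Proof.
move=> [fc fs] oU gs c ac; apply: smooth_on_local => _ [x [Ux cx] <-].
have [d ad dx] := @atlas_cover _ _ Y (f x).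
have hc := atlas_chart ac; have hd := atlas_chart ad.
have [[oc _] cK _ _] := hc; have [[od _] dK _ _] := hd.
pose O := coord c @` ((f @^-1` (U `&` cdom d)) `&` cdom c).
have oO : open O.
  apply: open_coord => //.
  by apply: open_comp; [move=> ? _; exact: fc|exact: openI].
exists O; split; first by exists x.
apply: (@smooth_on_ext _ _ _ _ ((g \o coordV d) \o (coord d \o f \o coordV c))) => //.
  by move=> _ [y [[Uy dy] cy] <-] /=; rewrite cK// dK.
apply: smooth_on_comp oO _ _ (gs d ad).
  by move=> _ [_ [y [[Uy dy] cy] <-] <-]; exists (f y); rewrite //= cK.
apply: smooth_on_sub (fs _ _ ac ad).
by move=> _ [y [[Uy dy] cy] <-]; exists y.
Qed.

Lemma smooth_comp (g : Y -> R) : smooth_map f -> smooth g -> smooth (g \o f).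
Proof. by move=> fs gs; exact: smooth_fun_comp fs openT gs. Qed.

Lemma chart_vector_push (c : chart R m X) (d : chart R p Y) (x : X) v (g : Y -> R) :
  smooth_map f -> smooth_chart c -> smooth_chart d -> cdom c x -> cdom d (f x) ->
  smooth g ->
  chart_vector c x v (g \o f) =
    \sum_j ('D_v (coord d \o f \o coordV c) (coord c x)) 0 j *
           chart_vector d (f x) (delta_mx 0 j) g.
Proof.
move=> fs hc hd cx dx gs; have df := smooth_map_chart fs hc hd cx dx.
have dg := smooth_diff gs hd dx; have [[_ cK _ _] _] := hc.
have [[[od _] dK _ _] _] := hd; have [fc _] := fs.
rewrite chart_vectorE; last exact: smooth_comp.
rewrite (@near_eq_derive _ _ _ _ ((g \o coordV d) \o (coord d \o f \o coordV c))).
  rewrite derive_chain//; last by rewrite /= cK.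
  by apply: eq_bigr => j _; rewrite chart_vectorE// /= cK.
have /(near_coordV (proj1 hc) cx) : nbhs x (f @^-1` cdom d).
  apply: open_nbhs_nbhs; split; last by [].
  by apply: open_comp => // ? _; exact: fc.
by apply: filterS => u du /=; rewrite dK.
Qed.

End Maps.

Lemma smooth_map_id (R : realType) (n : nat) (X : manifold R n) :
  smooth_map (fun x : X => x).
Proof.
split=> [x|c d ac ad]; first exact: cvg_id.
exact: (proj1 (atlas_compatible ac ad)).
Qed.

Section Sections.
Variables (R : realType) (n : nat) (X : manifold R n) (r : nat) (E : vbundle X r).

(** Identities that only hold for smooth sections become identities for vectors by
    means of this extension, a local frame multiplied by a bump function. *)
Lemma section_through (x : X) (a : E x) :
  exists2 s : forall y, E y, smooth_section s & s x = a.
Proof.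
have [i ix] := @triv_cover _ _ _ _ E x.
have [chi [K [chis chi0 Kc KU hK]]] := bump_function (@triv_open _ _ _ _ E i) ix.
pose v := triv i x a.
exists (fun y => (chi y / chi x) *: @trivV _ _ _ _ E i y v).
  move=> j; apply: smooth_fun_local => y jy.
  have [iy|niy] := pselect (@triv_dom _ _ _ _ E i y).
    pose U := @triv_dom _ _ _ _ E i `&` triv_dom j.
    have oU : open U by apply: openI; exact: triv_open.
    exists U; split=> //.
    have ts := @triv_smooth _ _ _ _ E i j v.
    apply/smooth_fun_rV => // k; move/smooth_fun_rV : ts => /(_ oU k) ts.
    apply: (@smooth_fun_ext _ _ _ _ _ (fun y => (chi y * (chi x)^-1) *
      triv j y (@trivV _ _ _ _ E i y v) 0 k)) => //.
      by move=> z _; rewrite linearZ mxE.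
    apply: smooth_funM => //; apply: smooth_funM => //; last exact: smooth_fun_cst.
    exact: smooth_fun_sub chis.
  exists (~` K); split; first by move=> /KU.
  apply: (@smooth_fun_ext _ _ _ _ _ (fun=> 0)); first exact: closed_openC.
    by move=> z nKz; rewrite hK// mul0r scale0r linear0.
  by apply: smooth_fun_cst; exact: closed_openC.
by rewrite divff ?gt_eqF// scale1r /v trivK.
Qed.

End Sections.

(** * Two-forms on a Lie algebroid *)

Lemma dfwithE (I : eqType) (T : Type) (v : I -> T) (i : I) (a : T) (j : I) :
  dfwith v i a j = if j == i then a else v j.
Proof.
case: eqVneq => [->|ji]; first by rewrite dfwithin.
by rewrite dfwithout// eq_sym.
Qed.

Lemma ord2_split (k : 'I_2) : k = 0 \/ k = 1.
Proof. by case: k => [[|[|]]]//= h; [left|right]; apply/val_inj. Qed.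

Section FiniteLimits.
Variables (R : realType) (T : Type) (F : set_system T).
Context {FF : Filter F}.

Lemma cvg_sumR (I : finType) (u : I -> T -> R) (l : I -> R) :
  (forall i, u i x @[x --> F] --> l i) ->
  \sum_i u i x @[x --> F] --> \sum_i l i.
Proof. by move=> ul; apply: cvg_big => //; exact: add_continuous. Qed.

Lemma cvg_prodR (I : finType) (u : I -> T -> R) (l : I -> R) :
  (forall i, u i x @[x --> F] --> l i) ->
  \prod_i u i x @[x --> F] --> \prod_i l i.
Proof. by move=> ul; apply: cvg_big => //; exact: mul_continuous. Qed.

Lemma cvg_det n (M : T -> 'M[R]_n) (L : 'M[R]_n) :
  (forall i j, M x i j @[x --> F] --> L i j) -> \det (M x) @[x --> F] --> \det L.
Proof.
move=> ML; apply: cvg_sumR => s; apply: cvgM; first exact: cvg_cst.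
by apply: cvg_prodR => i; exact: ML.
Qed.

Lemma cvg_adjugate n (M : T -> 'M[R]_n) (L : 'M[R]_n) i j :
  (forall i j, M x i j @[x --> F] --> L i j) ->
  (\adj (M x)) i j @[x --> F] --> (\adj L) i j.
Proof.
move=> ML; rewrite mxE; under eq_fun do rewrite mxE.
apply: cvgM; first exact: cvg_cst.
apply: cvg_det => k l; rewrite !mxE; under eq_fun do rewrite !mxE.
exact: ML.
Qed.

End FiniteLimits.

Section Frames.
Variables (R : realType) (n : nat) (X : manifold R n) (r : nat) (E : vbundle X r).

Definition triv_frame (i : triv_idx E) (x : X) (k : 'I_r) : E x :=
  @trivV _ _ _ _ E i x (delta_mx 0 k).

Lemma triv_frameE i x (a : E x) : triv_dom i x ->
  a = \sum_k triv i x a 0 k *: triv_frame i x k.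
Proof.
move=> ix; apply: (can_inj (trivK ix)).
rewrite linear_sum {1}[triv i x a]row_sum_delta; apply: eq_bigr => k _.
by rewrite linearZ /triv_frame /= trivVK.
Qed.

End Frames.

Section TwoForms.
Variables (R : realType) (n : nat) (X : manifold R n) (r : nat).
Variable A : lie_algebroid X r.
Variable w : forall x, ('I_2 -> A x) -> R.
Hypothesis wf : is_form w.

Lemma form_pair x (v : 'I_2 -> A x) : w v = w (pair_vec (v 0) (v 1)).
Proof. by congr w; apply/funext => k; case: (ord2_split k) => ->. Qed.

Lemma form_linl x a (s t b : A x) :
  w (pair_vec (a *: s + t) b) = a * w (pair_vec s b) + w (pair_vec t b).
Proof.
have [lin _ _] := wf.
have E c : pair_vec c b = dfwith (pair_vec s b) 0 c.
  by apply/funext => k; rewrite dfwithE; case: (ord2_split k) => ->.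
by rewrite E lin -!E.
Qed.

Lemma form_linr x a (s t b : A x) :
  w (pair_vec b (a *: s + t)) = a * w (pair_vec b s) + w (pair_vec b t).
Proof.
have [lin _ _] := wf.
have E c : pair_vec b c = dfwith (pair_vec b s) 1 c.
  by apply/funext => k; rewrite dfwithE; case: (ord2_split k) => ->.
by rewrite E lin -!E.
Qed.

Lemma form_alt x (a : A x) : w (pair_vec a a) = 0.
Proof. by have [_ alt _] := wf; apply: (alt _ _ 0 1). Qed.

Lemma formZl x k (a b : A x) : w (pair_vec (k *: a) b) = k * w (pair_vec a b).
Proof.
have z : w (pair_vec 0 b) = 0.
  by have := form_linl 1 0 0 b; rewrite scaler0 addr0 mul1r => /eqP;
    rewrite eq_sym -subr_eq0 addrK => /eqP.
by have := form_linl k a 0 b; rewrite addr0 z addr0.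
Qed.

Lemma formDl x (a a' b : A x) :
  w (pair_vec (a + a') b) = w (pair_vec a b) + w (pair_vec a' b).
Proof. by have := form_linl 1 a a' b; rewrite scale1r mul1r. Qed.

Lemma formC x (a b : A x) : w (pair_vec a b) = - w (pair_vec b a).
Proof.
have := form_alt (a + b); rewrite formDl.
have D c c' : w (pair_vec c (c' + b)) = w (pair_vec c c') + w (pair_vec c b).
  by have := form_linr 1 c' b c; rewrite scale1r mul1r.
by rewrite !D !form_alt add0r addr0 => /eqP; rewrite addr_eq0 => /eqP.
Qed.

Lemma formZr x k (a b : A x) : w (pair_vec a (k *: b)) = k * w (pair_vec a b).
Proof. by rewrite formC formZl -mulrN -formC. Qed.

Lemma form0l x (b : A x) : w (pair_vec 0 b) = 0.
Proof. by have := formZl 0 0 b; rewrite scale0r mul0r. Qed.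

Lemma form_suml x p (u : 'I_p -> A x) b :
  w (pair_vec (\sum_k u k) b) = \sum_k w (pair_vec (u k) b).
Proof.
exact: (big_morph (fun a => w (pair_vec a b)) (fun a c => formDl a c b) (form0l b)).
Qed.

Lemma form_sumr x p (u : 'I_p -> A x) b :
  w (pair_vec b (\sum_k u k)) = \sum_k w (pair_vec b (u k)).
Proof. by rewrite formC form_suml -sumrN; apply: eq_bigr => k _; rewrite -formC. Qed.

Lemma form_expand x p q (u : 'I_p -> R) (e : 'I_p -> A x)
    (v : 'I_q -> R) (g : 'I_q -> A x) :
  w (pair_vec (\sum_k u k *: e k) (\sum_l v l *: g l)) =
  \sum_k \sum_l u k * v l * w (pair_vec (e k) (g l)).
Proof.
rewrite form_suml; apply: eq_bigr => k _; rewrite form_sumr.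
by apply: eq_bigr => l _; rewrite formZl formZr mulrA.
Qed.

Definition form_coef (i : triv_idx A) (k l : 'I_r) (x : X) : R :=
  w (pair_vec (triv_frame i x k) (triv_frame i x l)).

Lemma form_triv i x (a b : A x) : triv_dom i x ->
  w (pair_vec a b) =
  \sum_k \sum_l triv i x a 0 k * triv i x b 0 l * form_coef i k l x.
Proof.
by move=> ix; rewrite {1}(triv_frameE a ix) {1}(triv_frameE b ix) form_expand.
Qed.

Lemma smooth_form_coef i k l : smooth_fun (triv_dom i) (form_coef i k l).
Proof.
have [_ _ ws] := wf; have := ws i (fun j => if j == 0 then delta_mx 0 k else delta_mx 0 l).
apply: smooth_fun_ext; first exact: triv_open.
by move=> x _; rewrite form_pair.
Qed.

Lemma smooth_form_on i (U : set X) (s t : forall x, A x) :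
  open U -> U `<=` triv_dom i ->
  smooth_fun U (fun x => triv i x (s x)) ->
  smooth_fun U (fun x => triv i x (t x)) ->
  smooth_fun U (fun x => w (pair_vec (s x) (t x))).
Proof.
move=> oU Ui /smooth_fun_rV ss /smooth_fun_rV ts.
apply: (@smooth_fun_ext _ _ _ _ _ (fun x => \sum_k \sum_l
  triv i x (s x) 0 k * triv i x (t x) 0 l * form_coef i k l x)) => //.
  by move=> x /Ui ix; rewrite -form_triv.
apply: smooth_fun_sum => // k; apply: smooth_fun_sum => // l.
apply: smooth_funM => //; last exact: smooth_fun_sub Ui (smooth_form_coef _ _ _).
by apply: smooth_funM => //; [exact: ss|exact: ts].
Qed.

Lemma smooth_form (s t : forall x, A x) : smooth_section s -> smooth_section t ->
  smooth (fun x => w (pair_vec (s x) (t x))).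
Proof.
move=> ss ts; apply: smooth_fun_local => x _.
have [i ix] := @triv_cover _ _ _ _ A x; exists (triv_dom i); split=> //.
by apply: (@smooth_form_on i) => //; exact: triv_open.
Qed.

Lemma continuous_form i x (s t : forall y, A y) : triv_dom i x ->
  (forall k, {for x, continuous (fun y => triv i y (s y) 0 k : R)}) ->
  (forall k, {for x, continuous (fun y => triv i y (t y) 0 k : R)}) ->
  {for x, continuous (fun y => w (pair_vec (s y) (t y)))}.
Proof.
move=> ix sc tc.
have ii : \forall y \near x, triv_dom i y.
  by apply: open_nbhs_nbhs; split=> //; exact: triv_open.
rewrite /prop_for /continuous_at (form_triv _ _ ix).
apply: (@cvg_trans _ ((fun y => \sum_k \sum_l
  triv i y (s y) 0 k * triv i y (t y) 0 l * form_coef i k l y) @ x)).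
  by apply: near_eq_cvg; apply: filterS ii => y iy; rewrite -form_triv.
apply: cvg_sumR => k; apply: cvg_sumR => l.
apply: cvgM; first by apply: cvgM; [exact: sc|exact: tc].
exact: smooth_fun_continuous (@triv_open _ _ _ _ A i) ix (smooth_form_coef i k l).
Qed.

End TwoForms.

Section LinearCombination.
Variables (R : realType) (n : nat) (X : manifold R n) (r : nat).
Variable A : lie_algebroid X r.
Variables w1 w2 : forall x, ('I_2 -> A x) -> R.
Hypotheses (wf1 : is_form w1) (wf2 : is_form w2).

Definition form_comb (K : R) : forall x, ('I_2 -> A x) -> R :=
  fun x v => K * w1 v + w2 v.

Lemma form_comb_is_form K : is_form (form_comb K).
Proof.
have [l1 a1 s1] := wf1; have [l2 a2 s2] := wf2; split.
- by move=> x v j a s t; rewrite /form_comb l1 l2; ring.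
- by move=> x v i j ij vij; rewrite /form_comb (a1 _ _ _ _ ij vij) (a2 _ _ _ _ ij vij); ring.
- move=> i v; have oi := @triv_open _ _ _ _ A i.
  apply: smooth_funD => //; apply: smooth_funM => //.
  exact: smooth_fun_cst.
Qed.

Lemma form_comb_closed K : closed_form w1 -> closed_form w2 ->
  closed_form (form_comb K).
Proof.
move=> c1 c2 v vs x.
suff -> : koszul (form_comb K) v x = K * koszul w1 v x + koszul w2 v x.
  by rewrite -c1// -c2//; ring.
rewrite /koszul mulrDr addrACA; congr (_ + _);
  rewrite mulr_sumr -big_split /=; apply: eq_bigr => i _.
  have [lin _ _] := anchor_tangent (v i x).
  rewrite mulrCA -mulrDr; congr (_ * _); apply: lin.
    have := smooth_form wf1 (vs (lift i 0)) (vs (lift i 1)).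
    by congr smooth; apply/funext => y; rewrite [RHS]form_pair.
  have := smooth_form wf2 (vs (lift i 0)) (vs (lift i 1)).
  by congr smooth; apply/funext => y; rewrite [RHS]form_pair.
rewrite mulr_sumr -big_split; apply: eq_bigr => j _ /=.
by rewrite /form_comb; ring.
Qed.

End LinearCombination.

Section Pullback.
Variables (R : realType) (m p : nat) (X : manifold R m) (Y : manifold R p).
Variables (r s : nat) (A : lie_algebroid X r) (B : lie_algebroid Y s).
Variables (f : X -> Y) (phi : forall x, {linear A x -> B (f x)}).

Lemma pullback_is_form (w : forall y, ('I_2 -> B y) -> R) :
  vbundle_map phi -> is_form w -> is_form (pullback phi w).
Proof.
move=> [fs phis] wf; have [lin alt _] := wf; have [fc _] := fs.
have E x (v : 'I_2 -> A x) : pullback phi w v = w _ (pair_vec (phi x (v 0)) (phi x (v 1))).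
  by rewrite /pullback form_pair.
split.
- move=> x v j a c c'; rewrite !E.
  by case: (ord2_split j) => ->; rewrite !dfwithE /= linearP;
    [exact: form_linl|exact: form_linr].
- by move=> x v i j ij vij; apply: (alt _ _ i j) => //; rewrite vij.
move=> i v; apply: smooth_fun_local => x ix.
have [j jx] := @triv_cover _ _ _ _ B (f x).
have oi := @triv_open _ _ _ _ A i; have oj := @triv_open _ _ _ _ B j.
have oJ : open (f @^-1` (@triv_dom _ _ _ _ B j)).
  by apply: open_comp => // ? _; exact: fc.
pose U := @triv_dom _ _ _ _ A i `&` f @^-1` (@triv_dom _ _ _ _ B j).
have oU : open U by exact: openI.
exists U; split=> //.
pose c l k y := triv j (f y) (phi y (@trivV _ _ _ _ A i y (v l))) 0 k.
have cs l k : smooth_fun U (c l k).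
  by have /smooth_fun_rV := phis i j (v l); apply.
apply: (@smooth_fun_ext _ _ _ _ _ (fun y => \sum_k \sum_l
  c 0 k y * c 1 l y * (form_coef w j k l \o f) y)) => //.
  by move=> y [iy jy]; rewrite E (form_triv wf _ _ jy).
apply: smooth_fun_sum => // k; apply: smooth_fun_sum => // l.
apply: smooth_funM => //; first exact: smooth_funM.
apply: smooth_fun_sub (smooth_fun_comp fs oj (smooth_form_coef wf j k l)).
by move=> y [].
Qed.

(** The chain map condition on functions says that phi intertwines the anchors
    along smooth sections; every vector lies on a smooth section. *)
Lemma morphism_anchor (x : X) (a : A x) (g : Y -> R) :
  lie_algebroid_morphism phi -> smooth g ->
  anchor B (f x) (phi x a) g = anchor A x a (g \o f).
Proof.
move=> [_ chain] gs; have [v vs <-] := section_through a.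
(* The zero-form g and its differential. *)
pose w0 y (_ : 'I_0 -> B y) : R := g y.
pose w1 y (u : 'I_1 -> B y) : R := anchor B y (u ord0) g.
have f0 : is_form w0.
  by split=> [y u []|y u []|i u] //; exact: smooth_fun_sub gs.
have f1 : is_form w1.
  split.
  - by move=> y u j a' c c'; rewrite [j]ord1 /w1 !dfwithE linearP.
  - by move=> y u i j; rewrite !ord1.
  - by move=> i u; exact: anchor_smooth.
have koszul0 (q : nat) (Z : manifold R q) t (C : lie_algebroid Z t)
    (h : Z -> R) (u : 'I_1 -> forall z, C z) z :
    koszul (fun y (_ : 'I_0 -> C y) => h y) u z = anchor C z (u ord0 z) h.
  rewrite /koszul big_ord1 expr0 mul1r big_ord1 big_pred0 ?addr0//.
  by move=> j; rewrite [j]ord1.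
have d01 : is_dA w0 w1 by move=> u us y; rewrite koszul0.
have := chain _ _ _ f0 f1 d01 (fun=> v) (fun=> vs) x.
by rewrite koszul0.
Qed.

End Pullback.

(** * Coordinate frames over the isomorphism locus *)

Section ChartFrame.
Variables (R : realType) (n r : nat) (X : manifold R n) (A : lie_algebroid X r).

(** Tangent vectors vanish on non-smooth functions by definition. *)
Lemma anchor_smooth_inj x (a b : A x) : iso_locus A x ->
  (forall g, smooth g -> anchor A x a g = anchor A x b g) -> a = b.
Proof.
move=> [_ inj _] ab; apply: inj; rewrite ?inE//; apply/funext => g.
have [gs|ngs] := pselect (smooth g); first exact: ab.
by have [_ _ ->] := anchor_tangent a => //; have [_ _ ->] := anchor_tangent b.
Qed.

(** Where the anchor is an isomorphism, this is the preimage of the coordinate frame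
    of the chart c; it compares A with the tangent bundle. *)
Definition chart_frame (c : chart R n X) (x : X) (k : 'I_n) : A x :=
  xget 0 [set a | anchor A x a = chart_vector c x (delta_mx 0 k)].

Lemma anchor_chart_frame c x k : iso_locus A x -> smooth_chart c -> cdom c x ->
  anchor A x (chart_frame c x k) = chart_vector c x (delta_mx 0 k).
Proof.
move=> [_ _ surj] hc cx; rewrite /chart_frame; case: xgetP => // none.
have [a _ aE] := surj _ (tangent_chart_vector (delta_mx 0 k) hc cx).
by have := none a; rewrite /= aE.
Qed.

Lemma anchor_sum x q (u : 'I_q -> R) (e : 'I_q -> A x) g :
  anchor A x (\sum_j u j *: e j) g = \sum_j u j * anchor A x (e j) g.
Proof.
rewrite linear_sum fct_sumE; apply: eq_bigr => j _.
by rewrite linearZ.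
Qed.

End ChartFrame.

Section Push.
Variables (R : realType) (m p : nat) (X : manifold R m) (Y : manifold R p).
Variables (r s : nat) (A : lie_algebroid X r) (B : lie_algebroid Y s).
Variables (f : X -> Y) (phi : forall x, {linear A x -> B (f x)}).

(** Since phi intertwines the anchors, it is the differential of f in the
    coordinate frames. *)
Lemma chart_frame_push c d x k : smooth_map f ->
  (forall a g, smooth g -> anchor B (f x) (phi x a) g = anchor A x a (g \o f)) ->
  smooth_chart c -> smooth_chart d -> cdom c x -> cdom d (f x) ->
  iso_locus A x -> iso_locus B (f x) ->
  phi x (chart_frame A c x k) =
    \sum_j ('D_(delta_mx 0 k) (coord d \o f \o coordV c) (coord c x)) 0 j *:
           chart_frame B d (f x) j.
Proof.
move=> fs phiE hc hd cx dx ix iy; apply: anchor_smooth_inj => // g gs.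
rewrite phiE// anchor_chart_frame// anchor_sum.
rewrite (chart_vector_push _ fs hc hd cx dx gs).
by apply: eq_bigr => j _; rewrite anchor_chart_frame.
Qed.

End Push.

(** This is the case where f and phi are identities. *)
Lemma chart_frame_change (R : realType) (n r : nat) (X : manifold R n)
    (A : lie_algebroid X r) (c d : chart R n X) (x : X) k :
  smooth_chart c -> smooth_chart d -> cdom c x -> cdom d x -> iso_locus A x ->
  chart_frame A c x k =
    \sum_j jacobian (transition c d) (coord c x) k j *: chart_frame A d x j.
Proof.
move=> hc hd cx dx ix.
have := @chart_frame_push _ _ _ _ _ _ _ A A (fun y => y) (fun y => idfun) c d x k
  (@smooth_map_id _ _ X) (fun _ _ _ => erefl) hc hd cx dx ix ix.
rewrite /= => ->; apply: eq_bigr => j _; congr (_ *: _).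
have dt : differentiable (transition c d) (coord c x).
  exact: (smooth_map_chart (@smooth_map_id _ _ X) hc hd cx dx).
by rewrite (deriveEjacobian _ dt) -rowE mxE.
Qed.

Section FrameMatrix.
Variables (R : realType) (n r : nat) (X : manifold R n) (E : vbundle X r).

Definition frame_matrix (i : triv_idx E) (x : X) (e : 'I_r -> E x) : 'M[R]_r :=
  \matrix_(k, l) triv i x (e k) 0 l.

Lemma frame_span i x (e : 'I_r -> E x) (a : E x) : triv_dom i x ->
  \det (frame_matrix i e) != 0 -> exists u : 'I_r -> R, a = \sum_k u k *: e k.
Proof.
move=> ix dE; pose M := frame_matrix i e.
have Mu : M \in unitmx by rewrite unitmxE unitfE.
exists (fun k => (triv i x a *m invmx M) 0 k); apply: (can_inj (trivK ix)).
rewrite linear_sum -{1}[triv i x a](mulmxKV Mu); apply/rowP => l.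
rewrite summxE mxE; apply: eq_bigr => k _; rewrite linearZ /=.
by rewrite [in RHS]mxE [M k l]mxE.
Qed.

Lemma frame_free i x (e : 'I_r -> E x) (u : 'I_r -> R) : triv_dom i x ->
  \det (frame_matrix i e) != 0 -> \sum_k u k *: e k = 0 -> forall k, u k = 0.
Proof.
move=> ix dE ue k; pose M := frame_matrix i e.
have Mu : M \in unitmx by rewrite unitmxE unitfE.
have : \row_j u j *m M = 0.
  apply/rowP => l; rewrite mxE.
  have := congr1 (fun a => triv i x a 0 l) ue.
  rewrite /= linear_sum linear0 summxE => <-.
  by apply: eq_bigr => j _; rewrite linearZ !mxE.
move=> /(congr1 (mulmx^~ (invmx M))); rewrite /= (mulmxK Mu) mul0mx.
by move=> /rowP/(_ k); rewrite !mxE.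
Qed.

Lemma triv_frame_det i x : triv_dom i x -> \det (frame_matrix i (triv_frame i x)) != 0.
Proof.
move=> ix; have -> : frame_matrix i (triv_frame i x) = 1%:M.
  by apply/matrixP => k l; rewrite !mxE trivVK// mxE eqxx /= eq_sym.
by rewrite det1 oner_neq0.
Qed.

End FrameMatrix.

Section FrameContinuity.
Variables (R : realType) (n : nat) (X : manifold R n) (A : lie_algebroid X n).

(** If g_1, ..., g_n are smooth functions whose differentials span at x, then
    the matrix of the coordinate frame is the quotient of the matrix of the
    partial derivatives of the g_k by the matrix of the derivatives of the g_k
    along a smooth frame of A: both depend continuously on the point. *)
Lemma chart_frame_matrix (c : chart R n X) (i : triv_idx A) (x : X) :
  smooth_chart c -> cdom c `<=` iso_locus A -> cdom c x -> triv_dom i x ->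
  \det (frame_matrix i (chart_frame A c x)) != 0 /\
  forall k l, {for x, continuous (fun y => triv i y (chart_frame A c y k) 0 l : R)}.
Proof.
move=> hc ciso cx ix; have [hc1 _] := hc; have [_ cK cc _] := hc1.
have [h [g [hs h0 gs gE]]] := cutoff_coordinates hc cx.
pose M y := frame_matrix i (chart_frame A c y).
pose rho y : 'M[R]_n := \matrix_(l, k) anchor A y (triv_frame i y l) (g k).
pose D y : 'M[R]_n := \matrix_(j, k) chart_vector c y (delta_mx 0 j) (g k).
pose G k (u : 'rV[R]_n) : R := (u 0 k + - coord c x 0 k) * h u.
have Gs k : smooth_on setT (G k).
  move=> q; have oT := @openT 'rV[R]_n; apply: CkM => //.
  by apply: CkD => //; [exact: Ck_coord|exact: Ck_cst].
have MrhoD y : cdom c y -> triv_dom i y -> M y *m rho y = D y.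
  move=> cy iy; apply/matrixP => j k; rewrite !mxE.
  rewrite -(anchor_chart_frame _ (ciso _ cy) hc cy) [in RHS](triv_frameE (chart_frame A c y j) iy).
  by rewrite anchor_sum; apply: eq_bigr => l _; rewrite !mxE.
have DE y j k : cdom c y -> D y j k = 'D_(delta_mx 0 j) (G k) (coord c y).
  move=> cy; rewrite mxE chart_vectorE//; apply: near_eq_derive.
  by apply: filterS (near_cimg hc1 cy) => u iu /=; rewrite gE.
have ncx : \forall y \near x, cdom c y by exact: near_cdom.
have nix : \forall y \near x, triv_dom i y.
  by apply: open_nbhs_nbhs; split=> //; exact: triv_open.
have Dc j k : D y j k @[y --> x] --> D x j k.
  rewrite (DE _ _ _ cx); apply: (@cvg_trans _
    ((fun y => 'D_(delta_mx 0 j) (G k) (coord c y)) @ x)).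
    by apply: near_eq_cvg; apply: filterS ncx => y cy; rewrite DE.
  apply: (@continuous_comp _ _ _ (coord c) ('D_(delta_mx 0 j) (G k))); first exact: cc.
  by have [_ /(_ (delta_mx 0 j))] := Gs k 1%N; apply.
have rhoc l k : rho y l k @[y --> x] --> rho x l k.
  have := smooth_fun_continuous (@triv_open _ _ _ _ A i) ix
    (@anchor_smooth _ _ _ _ A i (delta_mx 0 l) _ (gs k)).
  by rewrite /prop_for /continuous_at mxE; under [X in _ -> X @ _ --> _]eq_fun do rewrite mxE.
have Dx : D x = (h (coord c x))%:M.
  apply/matrixP => j k; rewrite DE// mxE.
  have dh : derivable h (coord c x) (delta_mx 0 j).
    by apply: diff_derivable; apply: smooth_on_differentiable hs _.
  have dk := is_deriveD (is_derive_coord (coord c x) (delta_mx 0 j) k)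
    (is_derive_cst (- coord c x 0 k) (coord c x) (delta_mx 0 j)).
  have := is_deriveM dk (derivableP dh); rewrite mulrfctE addrfctE => -[_ ->].
  rewrite subrr scale0r add0r addr0 mxE eqxx /=.
  by rewrite /GRing.scale /= mulr_natr [k == j]eq_sym.
have detDx : \det (M x) * \det (rho x) != 0.
  by rewrite -det_mulmx MrhoD// Dx det_scalar expf_neq0// gt_eqF.
have [detM detrho] : \det (M x) != 0 /\ \det (rho x) != 0.
  by move: detDx; rewrite mulf_eq0 negb_or => /andP[].
split=> // j k.
have drc : \det (rho y) @[y --> x] --> \det (rho x) by apply: cvg_det.
have ME y : cdom c y -> triv_dom i y -> \det (rho y) != 0 ->
    M y j k = (\det (rho y))^-1 * \sum_l D y j l * \adj (rho y) l k.
  move=> cy iy dr; apply: (mulfI dr); rewrite mulrA mulfV// mul1r.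
  have := MrhoD y cy iy => /(congr1 (fun Z => Z *m \adj (rho y))).
  rewrite -mulmxA mul_mx_adj mul_mx_scalar => /matrixP/(_ j k).
  by rewrite [X in X = _ -> _]mxE [X in _ = X -> _]mxE.
have Mj y : triv i y (chart_frame A c y j) 0 k = M y j k by rewrite mxE.
rewrite /prop_for /continuous_at Mj ME//.
apply: (@cvg_trans _
   ((fun y => (\det (rho y))^-1 * \sum_l D y j l * \adj (rho y) l k) @ x)).
  apply: near_eq_cvg; near=> y; rewrite Mj ME//.
  - by near: y.
  - by near: y.
  - by near: y; exact: cvgr_neq0 drc detrho.
apply: cvgM; first by apply: cvgV.
apply: cvg_sumR => l; apply: cvgM; first exact: Dc.
by apply: cvg_adjugate.
Unshelve. all: by end_near. Qed.

End FrameContinuity.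

(** * Alternating forms in dimension four *)

Local Notation i0 := (@Ordinal 4 0 isT).
Local Notation i1 := (@Ordinal 4 1 isT).
Local Notation i2 := (@Ordinal 4 2 isT).
Local Notation i3 := (@Ordinal 4 3 isT).

Section FourDim.
Variable R : realType.
Implicit Types a b : 'I_4 -> 'I_4 -> R.

Lemma sum4 (V : nmodType) (F : 'I_4 -> V) : \sum_k F k = F i0 + F i1 + F i2 + F i3.
Proof.
rewrite !big_ord_recl big_ord0 addr0 !addrA.
by congr (_ + _ + _ + _); congr F; apply/val_inj.
Qed.

Lemma ord4_split (k : 'I_4) : [\/ k = i0, k = i1, k = i2 | k = i3].
Proof.
by case: k => [[|[|[|[|]]]]]//= h; [constructor 1|constructor 2|constructor 3|constructor 4];
  apply/val_inj.
Qed.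

Definition alternating b := forall k l, b k l = - b l k.

Definition pfaffian b := b i0 i1 * b i2 i3 - b i0 i2 * b i1 i3 + b i0 i3 * b i1 i2.

(** The coefficient of the four-form [a /\ b], that is, the polarization of the
    Pfaffian. *)
Definition wedge a b :=
  a i0 i1 * b i2 i3 - a i0 i2 * b i1 i3 + a i0 i3 * b i1 i2
  + a i1 i2 * b i0 i3 - a i1 i3 * b i0 i2 + a i2 i3 * b i0 i1.

(** The Hodge dual bivector of b. *)
Definition star b (k l : 'I_4) : R :=
  nth 0 (nth [::] [:: [:: 0; b i2 i3; - b i1 i3; b i1 i2];
                      [:: - b i2 i3; 0; b i0 i3; - b i0 i2];
                      [:: b i1 i3; - b i0 i3; 0; b i0 i1];
                      [:: - b i1 i2; b i0 i2; - b i0 i1; 0]] k) l.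

Lemma alternating_diag b k : alternating b -> b k k = 0.
Proof. by move=> /(_ k k); lra. Qed.

Lemma alternatingE b : alternating b ->
  ((b i0 i0 = 0) * (b i1 i1 = 0) * (b i2 i2 = 0) * (b i3 i3 = 0) *
   (b i1 i0 = - b i0 i1) * (b i2 i0 = - b i0 i2) * (b i3 i0 = - b i0 i3) *
   (b i2 i1 = - b i1 i2) * (b i3 i1 = - b i1 i3) * (b i3 i2 = - b i2 i3))%type.
Proof. by move=> ab; do ![split]; by [exact: alternating_diag|exact: ab]. Qed.

Lemma pfaffianD K a b :
  pfaffian (fun k l => K * a k l + b k l) =
  K ^+ 2 * pfaffian a + K * wedge a b + pfaffian b.
Proof. by rewrite /pfaffian /wedge; ring. Qed.

Lemma star_pfaffian b m k : alternating b ->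
  \sum_l star b m l * b l k = - pfaffian b * (m == k)%:R.
Proof.
move=> ab; rewrite sum4 /pfaffian.
by case: (ord4_split m) => ->; case: (ord4_split k) => ->;
  rewrite /star /= !(alternatingE ab) ?mulr1 ?mulr0; ring.
Qed.

Lemma star_eq0 b : alternating b -> (forall k l, star b k l = 0) ->
  forall k l, b k l = 0.
Proof.
move=> ab s0 k l.
have := (s0 i0 i1, s0 i0 i2, s0 i0 i3, s0 i1 i2, s0 i1 i3, s0 i2 i3).
move=> [[[[[]]]]]; rewrite /star /= => e1 e2 e3 e4 e5 e6.
by case: (ord4_split k) => ->; case: (ord4_split l) => ->;
  rewrite ?(alternatingE ab); lra.
Qed.

(** Contraction is a derivation of the exterior algebra:
    [i_u (a /\ b) = i_u a /\ b + a /\ i_u b]. *)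
Lemma contract_wedge a b (u : 'I_4 -> R) m : alternating a -> alternating b ->
  \sum_l star a m l * (\sum_k b l k * u k) + \sum_l star b m l * (\sum_k a l k * u k)
  = - wedge a b * u m.
Proof.
move=> aa ab; rewrite !sum4 /wedge.
by case: (ord4_split m) => ->; rewrite /star /= !(alternatingE aa) !(alternatingE ab); ring.
Qed.

(** Laplace expansion along the first two rows. *)
Lemma det4 (J : 'M[R]_4) :
  \det J =
  let M k l := J k i0 * J l i1 - J k i1 * J l i0 in
  let N k l := J k i2 * J l i3 - J k i3 * J l i2 in
  M i0 i1 * N i2 i3 - M i0 i2 * N i1 i3 + M i0 i3 * N i1 i2
  + M i1 i2 * N i0 i3 - M i1 i3 * N i0 i2 + M i2 i3 * N i0 i1.
Proof.
(* With entries indexed by numbers, the indices in the minors compute. *)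
pose N (k l : nat) := J (inord k) (inord l).
have JN k l : J k l = N k l by rewrite /N !inord_val.
rewrite (expand_det_row _ ord0) !big_ord_recl big_ord0 /cofactor.
do ![rewrite (expand_det_row _ ord0) !big_ord_recl big_ord0 /cofactor].
rewrite !det_mx00 !mxE !JN /= /bump /=.
by rewrite /= !addn0 /=; ring.
Qed.

Lemma wedge_change (J : 'M[R]_4) a b a' b' : alternating a -> alternating b ->
  (forall k l, a' k l = \sum_p \sum_q J k p * J l q * a p q) ->
  (forall k l, b' k l = \sum_p \sum_q J k p * J l q * b p q) ->
  wedge a' b' = \det J * wedge a b.
Proof.
move=> aa ab aE bE.
pose M k l p q := J k p * J l q - J k q * J l p.
have E c c' : alternating c ->
    (forall k l, c' k l = \sum_p \sum_q J k p * J l q * c p q) ->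
    forall k l, c' k l = M k l i0 i1 * c i0 i1 + M k l i0 i2 * c i0 i2
    + M k l i0 i3 * c i0 i3 + M k l i1 i2 * c i1 i2 + M k l i1 i3 * c i1 i3
    + M k l i2 i3 * c i2 i3.
  by move=> ac cE k l; rewrite cE !sum4 !(alternatingE ac) /M; ring.
by rewrite /wedge !(E _ _ aa aE) !(E _ _ ab bE) det4 /M /=; ring.
Qed.

(** The value at u of the four-form [dF_0 /\ dF_1 /\ b], up to a factor 4, for
    [F = z_1 ^ 2 + z_2 ^ 2]: it is the restriction of b to the complex tangent
    line of the fibre of F through u, multiplied by [|u| ^ 2]. *)
Definition fibre_quad b (u : 'I_4 -> R) : R :=
  (u i0 ^+ 2 + u i1 ^+ 2) * b i2 i3 + (u i2 ^+ 2 + u i3 ^+ 2) * b i0 i1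
  + (u i0 * u i2 + u i1 * u i3) * (b i1 i2 - b i0 i3)
  - (u i0 * u i3 - u i1 * u i2) * (b i1 i3 + b i0 i2).

Lemma fibre_quadZ b t (u : 'I_4 -> R) :
  fibre_quad b (fun k => t * u k) = t ^+ 2 * fibre_quad b u.
Proof. by rewrite /fibre_quad; ring. Qed.

Lemma fibre_quad0 b (u : 'I_4 -> R) : (forall k, u k = 0) -> fibre_quad b u = 0.
Proof. by move=> u0; rewrite /fibre_quad !u0; ring. Qed.

(** A form that is semidefinite on the complex lines is compatible with the
    complex orientation: its (1,1) part has nonnegative square, and its (2,0)
    part contributes a sum of two squares. *)
Lemma pfaffian_ge0 b (sigma : R) : sigma ^+ 2 = 1 ->
  (forall u, 0 <= sigma * fibre_quad b u) -> 0 <= pfaffian b.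
Proof.
move=> s1 qb.
(* After multiplication by sigma, the Hermitian form has diagonal entries A and C
   and off-diagonal entry (beta - i gamma) / 2; the claim follows from the
   positivity of its determinant. *)
pose A := sigma * b i2 i3; pose C := sigma * b i0 i1.
pose beta := sigma * (b i1 i2 - b i0 i3); pose gamma := sigma * (b i1 i3 + b i0 i2).
pose N := beta ^+ 2 + gamma ^+ 2.
have N0 : 0 <= N by rewrite addr_ge0// sqr_ge0.
(* The values at (s, t (beta - i gamma)) suffice. *)
have qst s t : 0 <= A * s ^+ 2 + s * t * N + C * t ^+ 2 * N.
  have := qb (fun k : 'I_4 => nth 0 [:: s; 0; t * beta; - (t * gamma)] k).
  rewrite /fibre_quad /= (_ : _ * _ = A * s ^+ 2 + s * t * N + C * t ^+ 2 * N)//.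
  by rewrite /N /A /C /beta /gamma; ring.
have A0 : 0 <= A by have := qst 1 0; rewrite expr1n expr0n /=; lra.
have C0 : 0 <= C.
  have := qb (fun k : 'I_4 => nth 0 [:: 0; 0; 1; 0] k); rewrite /fibre_quad /= /C.
  by rewrite !expr0n !expr1n /=; lra.
have NAC : N <= 4 * (A * C).
  have [C1|] := ltP 0 C.
    have := qst (2 * C) (-1).
    rewrite (_ : _ + _ = C * (4 * (A * C) - N)); last by ring.
    by rewrite pmulr_rge0// subr_ge0.
  move=> C1; have Cz : C = 0 by apply/eqP; rewrite eq_le C1 C0.
  rewrite Cz !mulr0 leNgt; apply/negP => Np.
  have := qst 1 (- (A + 1) / N); rewrite Cz !mul0r addr0 expr1n mulr1 mul1r.
  by rewrite divfK ?gt_eqF//; lra.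
have AC : A * C = b i0 i1 * b i2 i3.
  by rewrite /A /C -[RHS]mul1r -s1; ring.
have NE : N = (b i1 i2 - b i0 i3) ^+ 2 + (b i1 i3 + b i0 i2) ^+ 2.
  by rewrite /N /beta /gamma -[RHS]mul1r -s1; ring.
have s2 := sqr_ge0 (b i1 i2 + b i0 i3); have s3 := sqr_ge0 (b i1 i3 - b i0 i2).
rewrite /pfaffian; move: NAC; rewrite AC NE; nra.
Qed.

End FourDim.

(** * Constancy of signs near an isolated point *)

Section PuncturedBall.
Variables (R : realType) (n : nat) (F : 'rV[R]_n.+2 -> R) (r : R).
Hypothesis r0 : 0 < r.
Hypothesis Fc : forall u, u != 0 -> `|u| < r -> {for u, continuous F}.
Hypothesis F0 : forall u, u != 0 -> `|u| < r -> F u != 0.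

Lemma segment_same_sign u v : `|u| < r -> `|v| < r ->
  (forall t : R, 0 <= t <= 1 -> (1 - t) *: u + t *: v != 0) -> 0 < F u * F v.
Proof.
move=> ur vr uv; pose g (t : R) := (1 - t) *: u + t *: v.
have gr t : 0 <= t <= 1 -> `|g t| < r.
  move=> /andP[t0 t1]; apply: le_lt_trans (ler_normD _ _) _.
  rewrite !normrZ !ger0_norm ?subr_ge0//.
  have [->|tn0] := eqVneq t 0; first by rewrite subr0 mul1r mul0r addr0.
  have tp : 0 < t by rewrite lt_neqAle eq_sym tn0.
  apply: (@lt_le_trans _ _ ((1 - t) * r + t * r)); last by rewrite -mulrDl subrK mul1r.
  apply: ler_ltD; last by rewrite ltr_pM2l.
  by rewrite ler_wpM2l ?subr_ge0// ltW.
have gc : continuous g.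
  move=> t; apply: cvgD; apply: cvgZr_tmp; last exact: cvg_id.
  by apply: cvgB; [exact: cvg_cst|exact: cvg_id].
have Fgc : {within `[0, 1], continuous (F \o g)}.
  apply: continuous_in_subspaceT => t; rewrite inE /= in_itv /= => t01.
  by apply: continuous_comp; [exact: gc|exact: Fc (uv _ t01) (gr _ t01)].
have g0 : g 0 = u by rewrite /g subr0 scale1r scale0r addr0.
have g1 : g 1 = v by rewrite /g subrr scale0r add0r scale1r.
have un : F u != 0 by rewrite -g0; apply: F0 (uv _ _) (gr _ _); rewrite lexx ler01.
have vn : F v != 0 by rewrite -g1; apply: F0 (uv _ _) (gr _ _); rewrite lexx ler01.
rewrite ltNge; apply/negP => uvle.
have uvlt : F u * F v < 0 by rewrite lt_neqAle uvle mulf_neq0.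
have : Num.min ((F \o g) 0) ((F \o g) 1) <= 0 <= Num.max ((F \o g) 0) ((F \o g) 1).
  rewrite /= g0 g1 ge_min le_max.
  have [u0|u0|u0] := ltgtP (F u) 0; last by rewrite u0 eqxx in un.
    by rewrite (nmulr_rlt0 _ u0) in uvlt; rewrite (ltW uvlt) orbT.
  by rewrite (pmulr_rlt0 _ u0) in uvlt; rewrite (ltW uvlt) orbT.
move=> /(IVT ler01 Fgc)[t]; rewrite in_itv /= => t01 Ft.
by have := F0 (uv _ t01) (gr _ t01); rewrite Ft eqxx.
Qed.

(** Two points of the punctured ball are joined by a segment avoiding the
    origin unless they are opposite; one of two fixed independent points is
    joined in this way to any given one. *)
Lemma punctured_ball_sign : exists sigma : R, sigma ^+ 2 = 1 /\
  forall u, u != 0 -> `|u| < r -> 0 < sigma * F u.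
Proof.
(* Two independent base points. *)
pose j0 : 'I_n.+2 := ord0; pose j1 : 'I_n.+2 := lift ord0 ord0.
have j01 : j0 != j1 by [].
pose e (j : 'I_n.+2) : 'rV[R]_n.+2 := (r / 2) *: delta_mx 0 j.
have r2 : 0 < r / 2 by rewrite divr_gt0.
have er j : `|e j| < r.
  rewrite /e normrZ gtr0_norm// (@le_lt_trans _ _ (r / 2))//.
    rewrite ger_pMr// /Num.norm /= mx_normrE; apply: bigmax_le => // -[a b] _.
    by rewrite !mxE; case: (_ && _); rewrite ?normr1 ?normr0.
  by rewrite ltr_pdivrMr// ltr_pMr// ltr1n.
have eE j k : e j 0 k = (r / 2) * (k == j)%:R by rewrite !mxE.
have e0 j : e j != 0.
  apply/negP => /eqP/rowP/(_ j); rewrite eE mxE eqxx mulr1 => h.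
  by rewrite h ltxx in r2.
have avoid j k (u : 'rV[R]_n.+2) t : u 0 k != 0 -> k != j -> (1 - t) *: e j + t *: u != 0.
  move=> uk kj; apply/negP => /eqP E.
  have := congr1 (fun v : 'rV[R]_n.+2 => v 0 k) E; rewrite !mxE (negbTE kj) !mulr0 add0r.
  move/eqP; rewrite mulf_eq0 (negbTE uk) orbF => /eqP t0.
  by move/eqP: E; rewrite t0 subr0 scale1r scale0r addr0 (negbTE (e0 j)).
have same j k (u : 'rV[R]_n.+2) : u 0 k != 0 -> k != j -> `|u| < r -> 0 < F (e j) * F u.
  by move=> uk kj ur; apply: segment_same_sign => // t _; exact: avoid uk kj.
have e01 : 0 < F (e j0) * F (e j1).
  apply: (same j0 j1) => //; first by rewrite eE eqxx mulr1 gt_eqF.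
have F00 := F0 (e0 j0) (er j0).
exists (Num.sg (F (e j0))); split; first by rewrite sqr_sg F00.
move=> u un ur.
have sgP (a b : R) : 0 < a * b -> 0 < Num.sg a * b.
  have [->|a0|a0] := sgrP a; first by rewrite mul0r ltxx.
    by rewrite mul1r pmulr_rgt0.
  by rewrite mulN1r oppr_gt0 nmulr_rgt0.
apply: sgP.
have [[k uk kj]|nk] := pselect (exists2 k, u 0 k != 0 & k != j0).
  exact: same uk kj ur.
have u0 : u 0 j0 != 0.
  apply: contraNN un => /eqP u00; apply/eqP/rowP => k; rewrite mxE.
  have [->//|kj] := eqVneq k j0.
  by apply/eqP/negP => /negP uk; apply: nk; exists k.
have h1 := same j1 j0 u u0 j01 ur.
have F1 := F0 (e0 j1) (er j1).
have F12 : 0 < F (e j1) ^+ 2 by rewrite exprn_even_gt0.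
rewrite -(pmulr_lgt0 _ F12); have := mulr_gt0 e01 h1.
by congr (0 < _); ring.
Qed.

End PuncturedBall.

(** * Pointwise nondegeneracy *)

Section Coefficients.
Variables (R : realType) (n r : nat) (X : manifold R n) (A : lie_algebroid X r).
Variables (w : forall x, ('I_2 -> A x) -> R) (q : nat).

Definition coef x (e : 'I_q -> A x) (k l : 'I_q) : R := w (pair_vec (e k) (e l)).

Lemma coef_antisym x (e : 'I_q -> A x) : is_form w ->
  forall k l, coef e k l = - coef e l k.
Proof. by move=> wf k l; exact: formC. Qed.

Lemma coef_change x (e e' : 'I_q -> A x) (J : 'M[R]_q) : is_form w ->
  (forall k, e k = \sum_j J k j *: e' j) ->
  forall k l, coef e k l = \sum_a \sum_b J k a * J l b * coef e' a b.
Proof. by move=> wf eE k l; rewrite {1}/coef !eE form_expand. Qed.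

End Coefficients.

Section RankFour.
Variables (R : realType) (n : nat) (X : manifold R n) (A : lie_algebroid X 4).
Variables (w : forall x, ('I_2 -> A x) -> R) (wf : is_form w).
Variables (x : X) (e : 'I_4 -> A x).
Hypothesis span : forall a : A x, exists u : 'I_4 -> R, a = \sum_k u k *: e k.
Hypothesis free : forall u : 'I_4 -> R, \sum_k u k *: e k = 0 -> forall k, u k = 0.

Let alt : alternating (coef w e).
Proof. exact: coef_antisym. Qed.

Lemma form_coef_r (u : 'I_4 -> R) l :
  w (pair_vec (\sum_k u k *: e k) (e l)) = \sum_k u k * coef w e k l.
Proof. by rewrite form_suml//; apply: eq_bigr => k _; rewrite formZl. Qed.

(** The matrix of the dual bivector inverts that of the form up to the Pfaffian. *)
Lemma nondegenerate_of_pfaffian :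
  pfaffian (coef w e) != 0 -> nondegenerate_on [set: A x] w.
Proof.
move=> pf a _ wa; have [u aE] := span a.
have ub l : \sum_k u k * coef w e k l = 0 by rewrite -form_coef_r -aE wa.
have u0 m : u m = 0.
  apply: (mulfI pf); rewrite mulr0.
  have : \sum_l (\sum_k u k * coef w e k l) * star (coef w e) m l = 0.
    by rewrite big1// => l _; rewrite ub mul0r.
  have -> : \sum_l (\sum_k u k * coef w e k l) * star (coef w e) m l =
    - \sum_k u k * \sum_l star (coef w e) m l * coef w e l k.
    rewrite -sumrN; under [LHS]eq_bigr do rewrite mulr_suml.
    rewrite exchange_big; apply: eq_bigr => k _; rewrite mulr_sumr -sumrN.
    by apply: eq_bigr => l _; rewrite [coef w e l k]alt; ring.
  rewrite (bigD1 m)//= [X in _ + X]big1 ?addr0 => [|k km]; last first.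
    by rewrite star_pfaffian// eq_sym (negbTE km) !mulr0.
  by rewrite star_pfaffian// eqxx mulr1 mulrN opprK mulrC.
by rewrite aE big1// => k _; rewrite u0 scale0r.
Qed.

(** If the Pfaffian vanishes, then the rows of the dual bivector are in the kernel
    of the form. *)
Lemma pfaffian_of_nondegenerate :
  nondegenerate_on [set: A x] w -> pfaffian (coef w e) != 0.
Proof.
move=> nd; apply/negP => /eqP pf.
have null a : (forall l, w (pair_vec a (e l)) = 0) -> a = 0.
  move=> al; apply: nd => // b _; have [u ->] := span b.
  by rewrite form_sumr// big1// => l _; rewrite formZr// al mulr0.
have s0 m l : star (coef w e) m l = 0.
  apply: (@free (star (coef w e) m)); apply: null => k.
  by rewrite form_coef_r star_pfaffian// pf oppr0 mul0r.
have b0 := star_eq0 alt s0.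
have e0 : e i0 = 0 by apply: null => l; exact: b0.
have s1 : \sum_k ((k == i0)%:R : R) *: e k = 0.
  rewrite (bigD1 i0)//= e0 scaler0 add0r big1// => k k0.
  by rewrite (negbTE k0) scale0r.
by have /eqP := free s1 i0; rewrite eqxx oner_eq0.
Qed.

End RankFour.

Section RankTwo.
Variables (R : realType) (n : nat) (X : manifold R n) (B : lie_algebroid X 2).
Variables (w : forall x, ('I_2 -> B x) -> R) (wf : is_form w).

Lemma sum2 (V : nmodType) (F : 'I_2 -> V) : \sum_k F k = F 0 + F 1.
Proof. by rewrite !big_ord_recl big_ord0 addr0; congr (_ + F _); apply/val_inj. Qed.

Lemma form_rank2 x (e : 'I_2 -> B x) (u v : 'I_2 -> R) :
  w (pair_vec (\sum_k u k *: e k) (\sum_k v k *: e k)) =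
  (u 0 * v 1 - u 1 * v 0) * w (pair_vec (e 0) (e 1)).
Proof.
rewrite form_expand// !sum2 !form_alt// (formC wf (e 1) (e 0)); ring.
Qed.

(** Cramer's rule in the plane, for the area form w. *)
Lemma rank2_cyclic x (u v t : B x) :
  w (pair_vec u v) *: t + w (pair_vec v t) *: u + w (pair_vec t u) *: v = 0.
Proof.
have [j jx] := @triv_cover _ _ _ _ B x.
have [area W] : exists area, forall a b, w (pair_vec a b) =
    (triv j x a 0 0 * triv j x b 0 1 - triv j x a 0 1 * triv j x b 0 0) * area.
  exists (w (pair_vec (triv_frame j x 0) (triv_frame j x 1))) => a b.
  by rewrite {1}(triv_frameE a jx) {1}(triv_frameE b jx) form_rank2.
apply: (can_inj (trivK jx)); rewrite !linearD !linearZ linear0; apply/rowP => k.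
rewrite !mxE !W; case: (ord2_split k) => ->; ring.
Qed.

End RankTwo.

Section PullbackRank.
Variables (R : realType) (m p : nat) (X : manifold R m) (Y : manifold R p).
Variables (A : lie_algebroid X 4) (B : lie_algebroid Y 2).
Variables (f : X -> Y) (phi : forall x, {linear A x -> B (f x)}).
Variables (w : forall y, ('I_2 -> B y) -> R) (eta : forall x, ('I_2 -> A x) -> R).
Hypotheses (wf : is_form w) (etaf : is_form eta).

Lemma pullback_pair x (a b : A x) :
  pullback phi w (pair_vec a b) = w (pair_vec (phi x a) (phi x b)).
Proof. by congr w; apply/funext => k; rewrite /pair_vec; case: ifP. Qed.

Lemma pullback_alternating x (e : 'I_4 -> A x) : alternating (coef (pullback phi w) e).
Proof. by move=> k l; rewrite /coef !pullback_pair; exact: formC. Qed.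

Lemma pullback_pfaffian x (e : 'I_4 -> A x) : pfaffian (coef (pullback phi w) e) = 0.
Proof.
have := rank2_cyclic wf (phi x (e i0)) (phi x (e i1)) (phi x (e i2)).
move=> /(congr1 (fun t => w (pair_vec t (phi x (e i3))))).
rewrite form0l// !formDl// !formZl// => <-.
rewrite /pfaffian /coef !pullback_pair (formC wf (phi x (e i2)) (phi x (e i0))).
by ring.
Qed.

(** The dual bivector of the pullback spans the kernel of phi, and the value of
    eta on it is the four-form [phi^* w /\ eta]. *)
Lemma wedge_pullback_neq0 x (e : 'I_4 -> A x) k0 l0 :
  (forall a : A x, exists u : 'I_4 -> R, a = \sum_k u k *: e k) ->
  (forall u : 'I_4 -> R, \sum_k u k *: e k = 0 -> forall k, u k = 0) ->
  nondegenerate_on [set a : A x | phi x a = 0] eta ->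
  coef (pullback phi w) e k0 l0 != 0 ->
  wedge (coef (pullback phi w) e) (coef eta e) != 0.
Proof.
set a := coef (pullback phi w) e; set b := coef eta e.
move=> span free nd; apply: contraNN => /eqP ab0; apply/eqP.
have alta : alternating a by exact: pullback_alternating.
have altb : alternating b by exact: coef_antisym.
have s0 q q' : star a q q' = 0.
  apply: (free (star a q)); apply: nd => [|v v0] /=.
    rewrite linear_sum; under eq_bigr do rewrite linearZ /=; rewrite sum4.
    pose u k := phi x (e k).
    have cyc i j k : a j k *: u i - a i k *: u j + a i j *: u k = 0.
      rewrite -[RHS](rank2_cyclic wf (u i) (u j) (u k)) /a /coef !pullback_pair.
      by rewrite (formC wf (u k) (u i)) scaleNr [LHS]addrC addrA.
    have cycN i j k : - (a j k *: u i) + a i k *: u j - a i j *: u k = 0.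
      by rewrite -[RHS]oppr0 -(cyc i j k) !opprD opprK.
    by case: (ord4_split q) => ->; rewrite /star /= -!/(u _) !scaleNr scale0r ?add0r ?addr0;
      [exact: cyc|exact: cycN|exact: cyc|exact: cycN].
  have [c vE] := span v; rewrite vE form_sumr//.
  have av l : \sum_k a l k * c k = 0.
    have : w (pair_vec (phi x (e l)) (phi x v)) = 0.
      by rewrite (v0 : phi x v = 0) (formC wf) form0l// oppr0.
    rewrite vE linear_sum; under eq_bigr do rewrite linearZ /=.
    rewrite form_sumr// => E; rewrite -[RHS]E; apply: eq_bigr => k _.
    by rewrite formZr// /a /coef pullback_pair mulrC.
  have := contract_wedge c q alta altb; rewrite ab0 oppr0 mul0r.
  rewrite [X in _ + X]big1 ?addr0 => [E|l _]; last by rewrite av mulr0.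
  rewrite -[RHS]E.
  under [RHS]eq_bigr do rewrite mulr_sumr.
  rewrite [RHS]exchange_big; apply: eq_bigr => k _.
  rewrite formZr// form_coef_r// mulr_sumr; apply: eq_bigr => l _.
  by rewrite /b; ring.
exact: star_eq0.
Qed.

End PullbackRank.

(** * The fibration near a critical point *)

Section LefschetzAlgebra.
Variable R : realType.

(** The partial derivatives of the real and imaginary parts of
    [z_1 ^ 2 + z_2 ^ 2]. *)
Definition lefschetz_re (u : 'I_4 -> R) (k : 'I_4) : R :=
  2 * nth 0 [:: u i0; - u i1; u i2; - u i3] k.
Definition lefschetz_im (u : 'I_4 -> R) (k : 'I_4) : R :=
  2 * nth 0 [:: u i1; u i0; u i3; u i2] k.

Lemma wedge_lefschetz_algebra (b : 'I_4 -> 'I_4 -> R) (u : 'I_4 -> R) (area : R) :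
  wedge (fun k l => (lefschetz_re u k * lefschetz_im u l -
                     lefschetz_im u k * lefschetz_re u l) * area) b =
  4 * area * fibre_quad b u.
Proof. by rewrite /wedge /fibre_quad /lefschetz_re /lefschetz_im /=; ring. Qed.

Lemma lefschetz_d0 (u : 'I_4 -> R) k : (forall l, u l = 0) ->
  lefschetz_re u k = 0 /\ lefschetz_im u k = 0.
Proof.
move=> u0; rewrite /lefschetz_re /lefschetz_im !u0 oppr0.
by case: (ord4_split k) => -> /=; rewrite mulr0.
Qed.

End LefschetzAlgebra.

Section ChartFrameCoefficients.
Variables (R : realType) (X : manifold R 4) (A : lie_algebroid X 4).
Variable c : chart R 4 X.
Hypotheses (hc : smooth_chart c) (ciso : cdom c `<=` iso_locus A).

Lemma chart_frame_span x : cdom c x ->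
  forall a : A x, exists u : 'I_4 -> R, a = \sum_k u k *: chart_frame A c x k.
Proof.
move=> cx a; have [i ix] := @triv_cover _ _ _ _ A x.
by have [dM _] := chart_frame_matrix hc ciso cx ix; exact: frame_span ix dM.
Qed.

Lemma chart_frame_free x : cdom c x ->
  forall u : 'I_4 -> R, \sum_k u k *: chart_frame A c x k = 0 -> forall k, u k = 0.
Proof.
move=> cx u; have [i ix] := @triv_cover _ _ _ _ A x.
by have [dM _] := chart_frame_matrix hc ciso cx ix; exact: frame_free ix dM.
Qed.

Lemma continuous_coef (w : forall x, ('I_2 -> A x) -> R) x k l : is_form w ->
  cdom c x -> coef w (chart_frame A c y) k l @[y --> x] --> coef w (chart_frame A c x) k l.
Proof.
move=> wf cx; have [i ix] := @triv_cover _ _ _ _ A x.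
have [_ Mc] := chart_frame_matrix hc ciso cx ix.
exact: (@continuous_form _ _ _ _ _ _ wf i x (fun y => chart_frame A c y k)
  (fun y => chart_frame A c y l)).
Qed.

End ChartFrameCoefficients.

Section Wedge.
Variables (R : realType) (T : Type) (F : set_system T).
Context {FF : Filter F}.
Variables (a b : T -> 'I_4 -> 'I_4 -> R) (la lb : 'I_4 -> 'I_4 -> R).
Hypotheses (al : forall k l, a x k l @[x --> F] --> la k l)
           (bl : forall k l, b x k l @[x --> F] --> lb k l).

Lemma cvg_wedge : wedge (a x) (b x) @[x --> F] --> wedge la lb.
Proof.
have ab k l k' l' : a x k l * b x k' l' @[x --> F] --> la k l * lb k' l'.
  by apply: cvgM; [exact: al|exact: bl].
by do ![apply: cvgD => //]; exact: cvgN.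
Qed.

Lemma cvg_pfaffian : pfaffian (b x) @[x --> F] --> pfaffian lb.
Proof.
have bb k l k' l' : b x k l * b x k' l' @[x --> F] --> lb k l * lb k' l'.
  by apply: cvgM; exact: bl.
by apply: cvgD => //; apply: cvgB.
Qed.

Lemma cvg_fibre_quad (u : T -> 'I_4 -> R) (lu : 'I_4 -> R) :
  (forall k, u x k @[x --> F] --> lu k) ->
  fibre_quad (b x) (u x) @[x --> F] --> fibre_quad lb lu.
Proof.
move=> ul; have uu k l : u x k * u x l @[x --> F] --> lu k * lu l.
  by apply: cvgM; exact: ul.
apply: cvgB; [apply: cvgD; [apply: cvgD|]|]; apply: cvgM.
- by apply: cvgD; exact: uu.
- exact: bl.
- by apply: cvgD; exact: uu.
- exact: bl.
- by apply: cvgD; exact: uu.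
- by apply: cvgB; exact: bl.
- by apply: cvgB; exact: uu.
- by apply: cvgD; exact: bl.
Qed.

End Wedge.

Section Regular.
Variables (R : realType) (m p : nat) (X : manifold R m) (Y : manifold R p).
Variables (A : lie_algebroid X 4) (B : lie_algebroid Y 2).
Variables (f : X -> Y) (phi : forall x, {linear A x -> B (f x)}).
Variables (w : forall y, ('I_2 -> B y) -> R) (eta : forall x, ('I_2 -> A x) -> R).
Hypotheses (wf : is_form w) (etaf : is_form eta).
Hypothesis eta_ker : forall x, nondegenerate_on [set a : A x | phi x a = 0] eta.

(** For a nondegenerate form w on a bundle of rank two, this says that phi is
    surjective at x. *)
Definition regular_at x := exists a b : A x, w (pair_vec (phi x a) (phi x b)) != 0.

Definition wedge_at x (e : 'I_4 -> A x) : R :=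
  wedge (coef (pullback phi w) e) (coef eta e).

Lemma wedge_at_neq0 x (e : 'I_4 -> A x) :
  (forall a : A x, exists u : 'I_4 -> R, a = \sum_k u k *: e k) ->
  (forall u : 'I_4 -> R, \sum_k u k *: e k = 0 -> forall k, u k = 0) ->
  regular_at x -> wedge_at e != 0.
Proof.
move=> span free [a [b ab]].
have [[k [l kl]]|no] := pselect (exists k l, coef (pullback phi w) e k l != 0).
  exact: (@wedge_pullback_neq0 _ _ _ _ _ _ _ _ phi w eta wf etaf x e k l span free (@eta_ker x) kl).
exfalso; move/eqP: ab; apply.
have [u ->] := span a; have [v ->] := span b; rewrite !linear_sum.
under eq_bigr do rewrite linearZ /=.
under [X in pair_vec _ X]eq_bigr do rewrite linearZ /=.
rewrite form_expand// big1// => k _; rewrite big1// => l _.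
rewrite -pullback_pair; suff -> : pullback phi w (pair_vec (e k) (e l)) = 0 by rewrite mulr0.
by apply: contrapT => /eqP kl; apply: no; exists k, l.
Qed.

Lemma regular_at_surj x : nondegenerate_on [set: B (f x)] w ->
  set_surj setT setT (phi x) -> regular_at x.
Proof.
move=> nd surj; apply: contrapT => no.
have [j jx] := @triv_cover _ _ _ _ B (f x).
have e0 : triv_frame j (f x) (0 : 'I_2) = 0.
  apply: nd => // b _; have [a _ aE] := surj _ (I : setT (triv_frame j (f x) (0 : 'I_2))).
  have [a' _ <-] := surj _ (I : setT b); rewrite -aE.
  by apply: contrapT => /eqP ab; apply: no; exists a, a'.
have := congr1 (fun a => triv j (f x) a 0 0) e0.
by rewrite /triv_frame trivVK// linear0 !mxE eqxx /= => /eqP; rewrite oner_eq0.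
Qed.

End Regular.

Section LefschetzChart.
Variables (R : realType) (X : manifold R 4) (Y : manifold R 2).
Variables (A : lie_algebroid X 4) (B : lie_algebroid Y 2).
Variables (f : X -> Y) (phi : forall x, {linear A x -> B (f x)}).
Hypothesis phi_map : vbundle_map phi.
Hypothesis phi_anchor : forall x (a : A x) g, smooth g ->
  anchor B (f x) (phi x a) g = anchor A x a (g \o f).
Variables (c : chart R 4 X) (d : chart R 2 Y).
Hypotheses (hc : smooth_chart c) (hd : smooth_chart d).
Hypotheses (ciso : cdom c `<=` iso_locus A) (diso : cdom d `<=` iso_locus B).
Hypothesis cd : f @` cdom c `<=` cdom d.
Hypothesis cdE : forall y, cdom c y ->
  zcoord (coord d (f y)) 0 = \sum_(j < 2) zcoord (coord c y) j ^+ 2.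

Let F := coord d \o f \o coordV c.

Lemma lefschetz_coord y : cdom c y -> let u := coord c y 0 in
  coord d (f y) 0 0 = u i0 * u i0 - u i1 * u i1 + (u i2 * u i2 - u i3 * u i3) /\
  coord d (f y) 0 1 = u i0 * u i1 + u i1 * u i0 + (u i2 * u i3 + u i3 * u i2).
Proof.
move=> cy /=; have := cdE cy.
have nth4 (k : 'I_4) : nthcoord (coord c y) k = coord c y 0 k by rewrite /nthcoord valK.
have nth2 (k : 'I_2) : nthcoord (coord d (f y)) k = coord d (f y) 0 k.
  by rewrite /nthcoord valK.
rewrite !big_ord_recl big_ord0 addr0 /zcoord /=.
rewrite (nth4 i0) (nth4 i1) (nth4 i2) (nth4 i3) (nth2 0) (nth2 1) !expr2.
by move=> [-> ->].
Qed.

Lemma derive_lefschetz y k : cdom c y ->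
  ('D_(delta_mx 0 k) F (coord c y)) 0 0 = lefschetz_re (coord c y 0) k /\
  ('D_(delta_mx 0 k) F (coord c y)) 0 1 = lefschetz_im (coord c y 0) k.
Proof.
move=> cy; set u := coord c y; set v := delta_mx 0 k.
have [hc1 _] := hc; have dy : cdom d (f y) by apply: cd; exists y.
have dF : derivable F u v.
  by apply: diff_derivable; exact: smooth_map_chart (proj1 phi_map) hc hd cy dy.
have near_u : \forall z \near u, cimg c z by exact: near_cimg.
have q (i j : 'I_4) : is_derive u v (fun z : 'rV[R]_4 => z 0 i * z 0 j)
    (u 0 i * v 0 j + u 0 j * v 0 i).
  by have := is_deriveM (is_derive_coord u v i) (is_derive_coord u v j).
have Fz z : cimg c z -> F z 0 0 = z 0 i0 * z 0 i0 - z 0 i1 * z 0 i1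
      + (z 0 i2 * z 0 i2 - z 0 i3 * z 0 i3) /\
    F z 0 1 = z 0 i0 * z 0 i1 + z 0 i1 * z 0 i0 + (z 0 i2 * z 0 i3 + z 0 i3 * z 0 i2).
  move=> iz; have := lefschetz_coord (coordV_dom hc1 iz).
  by rewrite /= coordK.
have v_ i : v 0 i = (i == k)%:R by rewrite mxE.
rewrite derive_mx// !mxE; split.
- have D := is_deriveD (is_deriveB (q i0 i0) (q i1 i1)) (is_deriveB (q i2 i2) (q i3 i3)).
  have E : \near u, (fun z : 'rV[R]_4 => z 0 i0 * z 0 i0 - z 0 i1 * z 0 i1
      + (z 0 i2 * z 0 i2 - z 0 i3 * z 0 i3)) u = F u 0 0.
    by apply: filterS near_u => z /Fz[-> _].
  have [_ ->] := near_eq_is_derive E D.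
  by rewrite !v_ /lefschetz_re; case: (ord4_split k) => -> /=; ring.
- have D := is_deriveD (is_deriveD (q i0 i1) (q i1 i0)) (is_deriveD (q i2 i3) (q i3 i2)).
  have E : \near u, (fun z : 'rV[R]_4 => z 0 i0 * z 0 i1 + z 0 i1 * z 0 i0
      + (z 0 i2 * z 0 i3 + z 0 i3 * z 0 i2)) u = F u 0 1.
    by apply: filterS near_u => z /Fz[_ ->].
  have [_ ->] := near_eq_is_derive E D.
  by rewrite !v_ /lefschetz_im; case: (ord4_split k) => -> /=; ring.
Qed.

Lemma chart_frame_lefschetz y k : cdom c y ->
  phi y (chart_frame A c y k) =
    lefschetz_re (coord c y 0) k *: chart_frame B d (f y) 0 +
    lefschetz_im (coord c y 0) k *: chart_frame B d (f y) 1.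
Proof.
move=> cy; have dy : cdom d (f y) by apply: cd; exists y.
have [re im] := derive_lefschetz k cy.
rewrite (chart_frame_push k (proj1 phi_map) (@phi_anchor y) hc hd cy dy (ciso cy) (diso dy)).
by rewrite sum2 -re -im.
Qed.

Variables (w : forall y, ('I_2 -> B y) -> R) (eta : forall x, ('I_2 -> A x) -> R).
Hypotheses (wf : is_form w) (etaf : is_form eta).

Lemma wedge_lefschetz y : cdom c y ->
  wedge_at phi w eta (chart_frame A c y) =
    4 * w (pair_vec (chart_frame B d (f y) 0) (chart_frame B d (f y) 1)) *
    fibre_quad (coef eta (chart_frame A c y)) (coord c y 0).
Proof.
move=> cy; set area := w _.
have aE k l : coef (pullback phi w) (chart_frame A c y) k l =
    (lefschetz_re (coord c y 0) k * lefschetz_im (coord c y 0) l -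
     lefschetz_im (coord c y 0) k * lefschetz_re (coord c y 0) l) * area.
  have E := f_equal2 (fun s t => w (pair_vec s t))
    (chart_frame_lefschetz k cy) (chart_frame_lefschetz l cy).
  rewrite /coef pullback_pair [LHS]E.
  pose u k' (j : 'I_2) := if j == 0 then lefschetz_re (coord c y 0) k'
    else lefschetz_im (coord c y 0) k'.
  by have := form_rank2 wf (chart_frame B d (f y)) (u k) (u l); rewrite !sum2 /u /=.
rewrite -wedge_lefschetz_algebra /wedge_at.
by congr wedge; apply/funext => k; apply/funext => l; exact: aE.
Qed.

(** Outside the critical point the fibres are complex curves on which eta is
    nondegenerate, hence of constant sign near the critical point; in the limit
    eta is semidefinite on every complex line. *)
Lemma lefschetz_signs x :
  (forall y, nondegenerate_on [set a : A y | phi y a = 0] eta) ->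
  cdom c x -> coord c x = 0 ->
  (\forall y \near x, y <> x -> regular_at phi w y) ->
  (exists sigma : R, sigma ^+ 2 = 1 /\ \forall y \near x,
     y <> x -> 0 < sigma * wedge_at phi w eta (chart_frame A c y)) /\
  wedge_at phi w eta (chart_frame A c x) = 0 /\
  \forall y \near x, 0 < pfaffian (coef eta (chart_frame A c y)).
Proof.
move=> nd cx x0 nreg; have [hc1 _] := hc; have [[odc _] cK cc cVc] := hc1.
have pf : is_form (pullback phi w) by exact: pullback_is_form.
pose b y := coef eta (chart_frame A c y).
pose a y := coef (pullback phi w) (chart_frame A c y).
have /nbhs_ballP[r /= r0 br] : \forall u \near coord c x,
    cimg c u /\ (coordV c u <> x -> regular_at phi w (coordV c u)).
  near=> u; split; near: u; first exact: near_cimg.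
  exact: (near_coordV hc1 cx nreg).
have inr u : `|u| < r -> cimg c u /\ (u != 0 -> regular_at phi w (coordV c u)).
  move=> ur; have [|iu reg] := br u.
    by rewrite x0 -ball_normE /= sub0r normrN.
  split=> // un; apply: reg => E; move: un; rewrite -x0 -E.
  by rewrite (coordK hc1 iu) eqxx.
have ndom u : `|u| < r -> cdom c (coordV c u).
  by move=> /inr[iu _]; exact: coordV_dom.
have bc u k l : `|u| < r -> b (coordV c z) k l @[z --> u] --> b (coordV c u) k l.
  move=> ur; have [iu _] := inr u ur.
  apply: (@continuous_comp _ _ _ (coordV c) (fun y => b y k l)); first exact: cVc.
  exact: (@continuous_coef _ _ _ _ hc ciso _ _ k l etaf (ndom u ur)).
have ac u k l : `|u| < r -> a (coordV c z) k l @[z --> u] --> a (coordV c u) k l.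
  move=> ur; have [iu _] := inr u ur.
  apply: (@continuous_comp _ _ _ (coordV c) (fun y => a y k l)); first exact: cVc.
  exact: (@continuous_coef _ _ _ _ hc ciso _ _ k l pf (ndom u ur)).
pose P u := wedge_at phi w eta (chart_frame A c (coordV c u)).
pose Q (u : 'rV[R]_4) := fibre_quad (b (coordV c u)) (u 0).
have PQ u : `|u| < r -> P u =
    4 * w (pair_vec (chart_frame B d (f (coordV c u)) 0)
                    (chart_frame B d (f (coordV c u)) 1)) * Q u.
  by move=> ur; have [iu _] := inr u ur; rewrite /P (wedge_lefschetz (ndom u ur)) (coordK hc1 iu).
have P0 u : u != 0 -> `|u| < r -> P u != 0.
  move=> un ur; have du := ndom u ur.
  apply: wedge_at_neq0 => //; [exact: chart_frame_span|exact: chart_frame_free|].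
  by apply: (proj2 (inr u ur)).
have Q0 u : u != 0 -> `|u| < r -> Q u != 0.
  by move=> un ur; apply: contraNN (P0 _ un ur) => /eqP q0; rewrite PQ// q0 mulr0.
have Pc u : u != 0 -> `|u| < r -> {for u, continuous P}.
  by move=> _ ur; exact: (cvg_wedge (fun k l => ac u k l ur) (fun k l => bc u k l ur)).
have Qc u : u != 0 -> `|u| < r -> {for u, continuous Q}.
  move=> _ ur; have uc k : (z : 'rV[R]_4) 0 k @[z --> u] --> u 0 k by exact: coord_continuous.
  exact: (cvg_fibre_quad (fun k l => bc u k l ur) uc).
have xr : `|0 : 'rV[R]_4| < r by rewrite normr0.
have xE : coordV c 0 = x by rewrite -x0 cK.
split; [|split].
- have [sigma [s1 sP]] := punctured_ball_sign r0 Pc P0; exists sigma; split=> //.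
  have nr : \forall u \near coord c x, `|u| < r.
    by rewrite x0; apply/nbhs_ballP; exists r => // u; rewrite -ball_normE /= sub0r normrN.
  have nr' : \forall y \near x, `|coord c y| < r by exact: (cc _ cx _ nr).
  have ncx : \forall y \near x, cdom c y by exact: near_cdom.
  near=> y => yx.
  have cy : cdom c y by near: y.
  have := sP (coord c y); rewrite /P cK//; apply; last by near: y.
  by apply/eqP => y0; apply: yx; rewrite -(cK _ cy) y0.
- have := PQ 0 xr; rewrite /P xE => ->.
  by rewrite /Q fibre_quad0 ?mulr0// => k; rewrite mxE.
(* Along a ray through u the sign of [Q] is that of the form at the point of the
   ray, evaluated on the fixed vector u; let this point tend to x. *)
have [sigma [s1 sQ]] := punctured_ball_sign r0 Qc Q0.
have pf0 : 0 <= pfaffian (b x).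
  apply: (pfaffian_ge0 s1) => u; pose v : 'rV[R]_4 := \row_k u k.
  have vE : v 0 = u by apply/funext => k; rewrite mxE.
  have [v0|vn] := eqVneq v 0.
    by rewrite fibre_quad0 ?mulr0// => k; rewrite -vE v0 mxE.
  pose g (t : R) := sigma * fibre_quad (b (coordV c (t *: v))) u.
  have tc : (t : R) *: v @[t --> (0 : R)] --> (0 : 'rV[R]_4).
    by rewrite -[X in _ --> X](scale0r v); apply: cvgZr_tmp; exact: cvg_id.
  have gc : g t @[t --> (0 : R)] --> sigma * fibre_quad (b x) u.
    apply: cvgM; first exact: cvg_cst.
    apply: cvg_fibre_quad => [k l|k]; last exact: cvg_cst.
    have := bc 0 k l xr; rewrite xE; apply: cvg_comp; exact: tc.
  rewrite leNgt; apply/negP => neg.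
  have near0 : \forall t \near (0 : R), g t < 0 by exact: cvgr_lt gc _ neg.
  have nearr : \forall t \near (0 : R), `|t *: v| < r.
    by apply: (cvgr_norm_lt _ tc); rewrite normr0.
  have right (S : set R) : (\forall t \near (0 : R), S t) -> \forall t \near (0 : R)^'+, S t.
    by move=> S0; exact: cvg_within S0.
  near (0 : R)^'+ => t.
  have t0 : 0 < t by near: t; exact: nbhs_right_gt.
  have gt : g t < 0 by near: t; exact: right.
  have tr : `|t *: v| < r by near: t; exact: right.
  have := sQ (t *: v); rewrite scaler_eq0 (negbTE vn) (gt_eqF t0) => /(_ isT tr).
  rewrite /Q (_ : (t *: v) 0 = fun k => t * u k); last first.
    by apply/funext => k; rewrite !mxE.
  rewrite fibre_quadZ mulrCA pmulr_rgt0 ?exprn_gt0//.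
  by move=> /(lt_trans gt); rewrite ltxx.
(* The differential of f, and with it phi, vanishes at x. *)
have ndx : nondegenerate_on [set: A x] eta.
  have ker0 (v : A x) : phi x v = 0.
    have [u ->] := chart_frame_span hc ciso cx v.
    rewrite linear_sum big1// => k _; rewrite linearZ /= chart_frame_lefschetz//.
    have [l|-> ->] := @lefschetz_d0 R (coord c x 0) k; first by rewrite x0 mxE.
    have zero (v1 v2 : B (f x)) : 0 *: v1 + 0 *: v2 = 0 by rewrite !scale0r addr0.
    by rewrite zero scaler0.
  by move=> v _ vb; apply: nd => // v' _; exact: vb.
have pfx : 0 < pfaffian (b x).
  rewrite lt_neqAle pf0 andbT eq_sym.
  apply: pfaffian_of_nondegenerate => //; [exact: chart_frame_span|exact: chart_frame_free].
have pfc : pfaffian (b y) @[y --> x] --> pfaffian (b x).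
  by apply: cvg_pfaffian => k l; exact: (@continuous_coef _ _ _ _ hc ciso _ _ k l etaf cx).
exact: cvgr_gt pfc _ pfx.
Unshelve. all: by end_near. Qed.

End LefschetzChart.

(** * The sign of the fibrewise area along the isomorphism locus *)

Section GlobalSign.
Variables (R : realType) (X : manifold R 4) (Y : manifold R 2).
Variables (A : lie_algebroid X 4) (B : lie_algebroid Y 2).
Variables (f : X -> Y) (phi : forall x, {linear A x -> B (f x)}).
Variables (w : forall y, ('I_2 -> B y) -> R) (eta : forall x, ('I_2 -> A x) -> R).
Hypotheses (wf : is_form w) (etaf : is_form eta).
Hypothesis phi_map : vbundle_map phi.

Let P (c : chart R 4 X) x := wedge_at phi w eta (chart_frame A c x).

Let pf : is_form (pullback phi w). Proof. exact: pullback_is_form. Qed.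

Lemma wedge_at_chart_change (c d : chart R 4 X) x :
  smooth_chart c -> smooth_chart d -> cdom c x -> cdom d x -> iso_locus A x ->
  P c x = \det (jacobian (transition c d) (coord c x)) * P d x.
Proof.
move=> hc hd cx dx ix.
have E k := chart_frame_change k hc hd cx dx ix.
apply: wedge_change.
- exact: coef_antisym.
- exact: coef_antisym.
- exact: coef_change.
- exact: coef_change.
Qed.

Variable o : set (chart R 4 X).
Hypothesis oU : orientation (iso_locus A) o.

Let o_smooth c : o c -> smooth_chart c /\ cdom c `<=` iso_locus A.
Proof. by have [h _ _] := oU; exact: h. Qed.

(** The sign of [phi^* w /\ eta] is well defined relative to the orientation. *)
Lemma sign_oriented_chart c d x : oriented_chart o c -> o d -> cdom c x -> cdom d x ->
  exists2 t : R, 0 < t & P c x = t * P d x.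
Proof.
move=> [hc co] od cx dx; have [hd dU] := o_smooth od.
exists (\det (jacobian (transition c d) (coord c x))); first exact: co.
by apply: wedge_at_chart_change => //; exact: dU.
Qed.

Lemma orientation_chart c : o c -> oriented_chart o c.
Proof.
by move=> oc; split=> [|d od]; [exact: (proj1 (o_smooth oc))|have [_ _] := oU; exact].
Qed.

(** This holds at the points where phi is surjective by continuity, and at the
    others by the study of f near a critical point. *)
Hypothesis local_sign : forall x, iso_locus A x ->
  exists c, [/\ oriented_chart o c, cdom c `<=` iso_locus A, cdom c x &
   exists sigma : R, sigma ^+ 2 = 1 /\
     (\forall y \near x, y <> x -> 0 < sigma * P c y) /\ 0 <= sigma * P c x].

(** It follows from this that the two possible signs near a point exclude each
    other. *)
Lemma chart_not_isolated (c : chart R 4 X) x (N : set X) :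
  is_chart c -> cdom c x -> nbhs x N -> exists2 y, N y & cdom c y /\ y <> x.
Proof.
move=> hc cx Nx; have [_ cK _ _] := hc.
have nu : \forall u \near coord c x, cimg c u /\ N (coordV c u).
  by near=> u; split; near: u; [exact: near_cimg|exact: (near_coordV hc cx Nx)].
have [r /= r0 br] := (nbhs_ballP _ _).1 nu.
pose e : 'rV[R]_4 := (r / 2) *: delta_mx 0 ord0.
have r2 : 0 < r / 2 by rewrite divr_gt0.
have er : `|e| < r.
  rewrite /e normrZ gtr0_norm// (@le_lt_trans _ _ (r / 2))//.
    rewrite ger_pMr// /Num.norm /= mx_normrE; apply: bigmax_le => // -[a b] _.
    by rewrite !mxE; case: (_ && _); rewrite ?normr1 ?normr0.
  by rewrite ltr_pdivrMr// ltr_pMr// ltr1n.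
have [iu Nu] : cimg c (coord c x + e) /\ N (coordV c (coord c x + e)).
  by apply: br; rewrite -ball_normE /= opprD addNKr normrN.
exists (coordV c (coord c x + e)) => //; split; first exact: coordV_dom.
move=> /(congr1 (coord c)); rewrite coordK// -[RHS]addr0 => /addrI.
move=> /(congr1 (fun v : 'rV[R]_4 => v 0 ord0)).
by rewrite !mxE !eqxx mulr1 => h; rewrite h ltxx in r2.
Unshelve. all: by end_near. Qed.

(** The sign of [phi^* w /\ eta] relative to the orientation is locally
    constant away from isolated points, hence constant on the connected
    isomorphism locus. *)
Lemma global_sign : connected (iso_locus A) -> iso_locus A !=set0 ->
  exists epsilon : R, epsilon ^+ 2 = 1 /\
    forall c x, oriented_chart o c -> cdom c x -> iso_locus A x ->
      0 <= epsilon * P c x.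
Proof.
move=> conn [x1 x1U]; have [_ cov _] := oU.
pose S (s : R) : set X := [set y | forall d, o d -> cdom d y -> 0 <= s * P d y].
have loc x : iso_locus A x -> exists sigma : R, sigma ^+ 2 = 1 /\ nbhs x (S sigma).
  move=> xU; have [c [oc cU cx [sigma [s1 [sP sPx]]]]] := local_sign xU.
  exists sigma; split=> //; have [[hc _] _] := oc.
  have ncx : \forall y \near x, cdom c y by exact: near_cdom.
  near=> y => d od dy.
  have cy : cdom c y by near: y.
  have [t t0 PE] := sign_oriented_chart oc od cy dy.
  suff : 0 <= sigma * P c y by rewrite PE mulrCA pmulr_rge0.
  have [->//|yx] := pselect (y = x).
  by apply: ltW; apply: (near sP y).
have nonzero x (N : set X) : iso_locus A x -> nbhs x N ->
    exists2 y, N y & exists2 d, o d & cdom d y /\ P d y != 0.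
  move=> xU Nx; have [c [oc cU cx [sigma [s1 [sP sPx]]]]] := local_sign xU.
  have [[hc _] _] := oc.
  have [y [Ny sy] [cy yx]] := chart_not_isolated hc cx (filterI Nx sP).
  exists y => //; have [d od dy] := cov y (cU _ cy); exists d => //; split=> //.
  have [t t0 PE] := sign_oriented_chart oc od cy dy.
  by apply/negP => /eqP p0; have := sy yx; rewrite PE p0 !mulr0 ltxx.
have excl x : iso_locus A x -> nbhs x (S 1) -> nbhs x (S (-1)) -> False.
  move=> xU h1 h2; have [y [y1 y2] [d od [dy]]] := nonzero x _ xU (filterI h1 h2).
  move=> /negP; apply; have := y1 d od dy; have := y2 d od dy.
  by rewrite mul1r mulN1r oppr_ge0 eq_le => -> ->.
have dicho x : iso_locus A x -> nbhs x (S 1) \/ nbhs x (S (-1)).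
  move=> /loc[sigma [/eqP]]; rewrite sqrf_eq1 => /orP[]/eqP ->; by [left|right].
have fin (s : R) : s ^+ 2 = 1 -> (forall x, iso_locus A x -> nbhs x (S s)) ->
  exists epsilon : R, epsilon ^+ 2 = 1 /\
    forall c x, oriented_chart o c -> cdom c x -> iso_locus A x ->
      0 <= epsilon * P c x.
  move=> s1 all; exists s; split=> // c x oc cx xU.
  have [d od dx] := cov x xU; have [t t0 ->] := sign_oriented_chart oc od cx dx.
  by rewrite mulrCA pmulr_rge0//; apply: (nbhs_singleton (all x xU)).
have [h1|h1] := dicho _ x1U; last first.
- apply: (fin (-1)); first by rewrite sqrrN expr1n.
  have E : iso_locus A `&` interior (S (-1)) = iso_locus A.
    apply: conn; first by exists x1.
      by exists (interior (S (-1))) => //; exact: open_interior.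
    exists (~` (interior (S 1))); first by apply: open_closedC; exact: open_interior.
    apply/seteqP; split=> x [xU h]; split=> //; first by move=> h'; exact: (excl x xU h' h).
    by have [|//] := dicho x xU.
  by move=> x xU; have [_] : (iso_locus A `&` interior (S (-1))) x by rewrite E.
apply: (fin 1); first by rewrite expr1n.
have E : iso_locus A `&` interior (S 1) = iso_locus A.
  apply: conn; first by exists x1.
    by exists (interior (S 1)) => //; exact: open_interior.
  exists (~` (interior (S (-1)))); first by apply: open_closedC; exact: open_interior.
  apply/seteqP; split=> x [xU h]; split=> //; first by move=> h'; exact: (excl x xU h h').
  by have [//|] := dicho x xU.
by move=> x xU; have [_] : (iso_locus A `&` interior (S 1)) x by rewrite E.
Unshelve. all: by end_near. Qed.

End GlobalSign.

(** * Construction of the symplectic form *)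

Section Combination.
Variables (R : realType) (m p : nat) (X : manifold R m) (Y : manifold R p).
Variables (A : lie_algebroid X 4) (B : lie_algebroid Y 2).
Variables (f : X -> Y) (phi : forall x, {linear A x -> B (f x)}).
Variables (w : forall y, ('I_2 -> B y) -> R) (eta : forall x, ('I_2 -> A x) -> R).
Hypotheses (wf : is_form w) (etaf : is_form eta).
Hypothesis phi_map : vbundle_map phi.
Hypothesis eta_ker : forall x, nondegenerate_on [set a : A x | phi x a = 0] eta.

Let pf : is_form (pullback phi w). Proof. exact: pullback_is_form. Qed.

Lemma comb_nondegenerate x (e : 'I_4 -> A x) K :
  (forall a : A x, exists u : 'I_4 -> R, a = \sum_k u k *: e k) ->
  K * wedge_at phi w eta e + pfaffian (coef eta e) != 0 ->
  nondegenerate_on [set: A x] (form_comb (pullback phi w) eta K).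
Proof.
move=> span nz; apply: (@nondegenerate_of_pfaffian _ _ _ _ _ _ _ e) => //.
  exact: form_comb_is_form.
have := pfaffianD K (coef (pullback phi w) e) (coef eta e).
by rewrite pullback_pfaffian// mulr0 add0r => E; rewrite [X in X != _]E.
Qed.

(** Near a point where phi is surjective, [phi^* w /\ eta] is bounded away from
    0 and dominates [eta /\ eta] after multiplication by a large constant. *)
Lemma regular_nondegenerate x epsilon : regular_at phi w x -> epsilon ^+ 2 = 1 ->
  \forall y \near x & K \near +oo,
    nondegenerate_on [set: A y] (form_comb (pullback phi w) eta (K * epsilon)).
Proof.
move=> reg e1; have [i ix] := @triv_cover _ _ _ _ A x.
pose W y := wedge_at phi w eta (triv_frame i y).
pose Q y := pfaffian (coef eta (triv_frame i y)).
have span y (iy : triv_dom i y) (a : A y) : exists u : 'I_4 -> R,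
    a = \sum_k u k *: triv_frame i y k by eexists; exact: triv_frameE.
have Wx : W x != 0.
  apply: wedge_at_neq0 => //; first exact: span.
  by move=> u; apply: frame_free (ix) _; exact: triv_frame_det.
have cc (w' : forall x, ('I_2 -> A x) -> R) k l : is_form w' ->
    coef w' (triv_frame i y) k l @[y --> x] --> coef w' (triv_frame i x) k l.
  move=> wf'; exact: smooth_fun_continuous (@triv_open _ _ _ _ A i) ix
    (smooth_form_coef wf' i k l).
have Wc : W y @[y --> x] --> W x by exact: cvg_wedge (fun k l => cc _ k l pf) (fun k l => cc _ k l etaf).
have Qc : Q y @[y --> x] --> Q x by exact: cvg_pfaffian (fun k l => cc _ k l etaf).
have nix : \forall y \near x, triv_dom i y.
  by apply: open_nbhs_nbhs; split=> //; exact: triv_open.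
pose D := `|W x| / 2; have D0 : 0 < D by rewrite divr_gt0// normr_gt0.
pose C := `|Q x| + 1.
have nW : \forall y \near x, D < `|W y|.
  apply: (cvgr_gt (`|W x|)); first exact: cvg_norm Wc.
  by rewrite /D ltr_pdivrMr// ltr_pMr ?normr_gt0// ltr1n.
have nQ : \forall y \near x, `|Q y| < C.
  by apply: (cvgr_lt (`|Q x|)); [exact: cvg_norm Qc|rewrite /C ltrDl].
near=> y K.
have iy : triv_dom i y by near: y.
apply: (@comb_nondegenerate _ (triv_frame i y)); first exact: span.
apply/negP => /eqP E.
have Wy : D < `|W y| by near: y.
have Qy : `|Q y| < C by near: y.
have K0 : 0 < K by near: K; apply: nbhs_pinfty_gt; exact: num_real.
have KC : C / D < K by near: K; apply: nbhs_pinfty_gt; exact: num_real.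
have eN : `|epsilon| = 1.
  by apply/eqP; rewrite -(@eqrXn2 _ 2)// expr1n real_normK ?num_real// e1.
have : Q y = - (K * epsilon * W y) by apply/eqP; rewrite -addr_eq0 addrC; apply/eqP.
move=> /(congr1 Num.norm); rewrite normrN !normrM eN mulr1 gtr0_norm// => QE.
have : C < K * `|W y|.
  by rewrite ltr_pdivrMr// in KC; apply: lt_trans KC _; rewrite ltr_pM2l.
by rewrite -QE => /(lt_trans Qy); rewrite ltxx.
Unshelve. all: by end_near. Qed.

End Combination.

Section Critical.
Variables (R : realType) (X : manifold R 4) (Y : manifold R 2).
Variables (A : lie_algebroid X 4) (B : lie_algebroid Y 2).
Variables (f : X -> Y) (phi : forall x, {linear A x -> B (f x)}).
Variables (w : forall y, ('I_2 -> B y) -> R) (eta : forall x, ('I_2 -> A x) -> R).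
Hypotheses (wf : is_form w) (etaf : is_form eta).
Hypothesis phi_map : vbundle_map phi.
Hypothesis phi_anchor : forall x (a : A x) g, smooth g ->
  anchor B (f x) (phi x a) g = anchor A x a (g \o f).
Hypothesis eta_ker : forall x, nondegenerate_on [set a : A x | phi x a = 0] eta.
Hypothesis w_nd : forall y, nondegenerate_on [set: B y] w.
Hypothesis lefschetz : lefschetz_fibration 2 (iso_locus A) (iso_locus B) f.
Hypothesis irregular : forall x, ~ regular_at phi w x ->
  iso_locus A x /\ (\forall y \near x, y <> x -> regular_at phi w y).

Let pf : is_form (pullback phi w). Proof. exact: pullback_is_form. Qed.

Lemma regular_point_regular_at x : iso_locus A x -> regular_point f x ->
  regular_at phi w x.
Proof.
move=> ix reg; have [_ fU _ _ _] := lefschetz.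
have iy : iso_locus B (f x) by apply: fU; exists x.
apply: regular_at_surj; first exact: w_nd.
move=> b _; have [D tD DE] := reg _ (anchor_tangent b).
have [_ _ surj] := ix; have [a _ aE] := surj _ tD; exists a => //.
apply: anchor_smooth_inj => // g gs.
by rewrite phi_anchor// aE DE.
Qed.

(** At an irregular point the form eta is symplectic and positive for the
    orientation of the isomorphism locus; with the right sign, adding multiples
    of the pullback preserves this positivity. *)
Lemma irregular_nondegenerate : iso_locus A !=set0 ->
  exists epsilon : R, epsilon ^+ 2 = 1 /\
    forall x, ~ regular_at phi w x -> \forall y \near x, forall K, 0 <= K ->
      nondegenerate_on [set: A y] (form_comb (pullback phi w) eta (K * epsilon)).
Proof.
move=> ne; have [_ fU [conn _] _ [_ [ori [oV [oU oVU lef]]]]] := lefschetz.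
have [osm ocov oor] := oU.
have chart_at x : ~ regular_at phi w x -> exists c d,
    [/\ oriented_chart ori c /\ smooth_chart d,
        cdom c `<=` iso_locus A /\ cdom d `<=` iso_locus B,
        cdom c x /\ coord c x = 0, f @` cdom c `<=` cdom d &
        forall y, cdom c y ->
          zcoord (coord d (f y)) 0 = \sum_(j < 2) zcoord (coord c y) j ^+ 2].
  move=> nreg; have [ix _] := irregular nreg.
  have crit : critical_point f x by move=> /(regular_point_regular_at ix).
  have [c [d [[oc [sd _]] [cU dV] [cx c0 _ _] cd cdE]]] := lef x ix crit.
  by exists c, d; split.
have local x : iso_locus A x -> exists c,
    [/\ oriented_chart ori c, cdom c `<=` iso_locus A, cdom c x &
     exists sigma : R, sigma ^+ 2 = 1 /\
     (\forall y \near x, y <> x -> 0 < sigma * wedge_at phi w eta (chart_frame A c y)) /\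
     0 <= sigma * wedge_at phi w eta (chart_frame A c x)].
  move=> ix; have [reg|nreg] := pselect (regular_at phi w x); last first.
    have [c [d [[oc sd] [cU dV] [cx c0] cd cdE]]] := chart_at x nreg.
    exists c; split=> //.
    have [[sigma [s1 sP]] [P0 _]] := lefschetz_signs phi_map phi_anchor (proj1 oc) sd cU dV cd
      cdE wf etaf eta_ker cx c0 (proj2 (irregular nreg)).
    by exists sigma; split=> //; split=> //; rewrite P0 mulr0.
  have [c oc cx] := ocov x ix; have [sc cU] := osm c oc.
  exists c; split=> //; first exact: (orientation_chart oU oc).
  have P0 : wedge_at phi w eta (chart_frame A c x) != 0.
    apply: wedge_at_neq0 => //; first exact: chart_frame_span.
    exact: chart_frame_free.
  have Pc : wedge_at phi w eta (chart_frame A c y) @[y --> x] -->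
      wedge_at phi w eta (chart_frame A c x).
    exact: (cvg_wedge (fun k l => @continuous_coef _ _ _ _ sc cU _ _ k l pf cx)
      (fun k l => @continuous_coef _ _ _ _ sc cU _ _ k l etaf cx)).
  set P := wedge_at phi w eta (chart_frame A c x) in P0 Pc *.
  have sP : 0 < Num.sg P * P by rewrite -normrEsg normr_gt0.
  exists (Num.sg P); split; first by rewrite sqr_sg P0.
  split; last exact: ltW.
  have sPc : Num.sg P * wedge_at phi w eta (chart_frame A c y) @[y --> x] --> Num.sg P * P.
    by apply: cvgM Pc; exact: cvg_cst.
  by apply: filterS (cvgr_gt _ sPc _ sP) => y.
have [epsilon [e1 eP]] := global_sign wf etaf phi_map oU local conn ne.
exists epsilon; split=> // x nreg.
have [c [d [[oc sd] [cU dV] [cx c0] cd cdE]]] := chart_at x nreg.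
have [_ [_ npf]] := lefschetz_signs phi_map phi_anchor (proj1 oc) sd cU dV cd
  cdE wf etaf eta_ker cx c0 (proj2 (irregular nreg)).
have ncx : \forall y \near x, cdom c y by apply: near_cdom cx; case: oc => -[].
near=> y => K K0; have cy : cdom c y by near: y.
apply: (@comb_nondegenerate _ _ _ _ _ _ _ _ _ _ _ wf etaf phi_map _ (chart_frame A c y)).
  by apply: chart_frame_span => //; case: oc.
rewrite gt_eqF//; apply: ltr_wpDl; last by near: y.
by rewrite -mulrA mulr_ge0//; apply: eP => //; exact: cU.
Unshelve. all: by end_near. Qed.

End Critical.

Theorem theorem1p1 (R : realType) (m p : nat)
    (X : manifold R m) (Sigma : manifold R p)
    (AX : lie_algebroid X 4) (AS : lie_algebroid Sigma 2)
    (f : X -> Sigma) (phi : forall x, {linear AX x -> AS (f x)}) :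
  compact [set: X] -> orientable X ->
  compact [set: Sigma] -> orientable Sigma ->
  lie_algebroid_lefschetz_fibration phi 2 ->
  connected_fibres AX AS f ->
  (exists w, @symplectic R p Sigma 2 AS w) ->
  (exists eta : forall x, ('I_2 -> AX x) -> R,
     [/\ is_form eta, closed_form eta &
         forall x, nondegenerate_on [set a : AX x | phi x a = 0] eta]) ->
  exists w, @symplectic R m X 4 AX w.
Proof.
move=> Xc _ _ _ [_ mor [Delta [isoD DA DB surj]] lef] _ [w [wf wc wnd]] [eta [ef ec ek]].
have phi_map := proj1 mor.
have regular x : ~ Delta x -> regular_at phi w x.
  by move=> nD; apply: regular_at_surj; [exact: wnd|exact: surj].
have irregular x : ~ regular_at phi w x ->
    iso_locus AX x /\ (\forall y \near x, y <> x -> regular_at phi w y).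
  move=> nreg; have Dx : Delta x by apply: contrapT => /regular.
  split; first exact: DA.
  have [_ [V Vx VD]] := isoD x Dx; apply: filterS Vx => y Vy yx.
  by apply: regular => Dy; apply: yx; have : [set x] y by rewrite -VD.
have [epsilon [e1 eN]] : exists epsilon : R, epsilon ^+ 2 = 1 /\
    forall x, ~ regular_at phi w x -> \forall y \near x, forall K, 0 <= K ->
      nondegenerate_on [set: AX y] (form_comb (pullback phi w) eta (K * epsilon)).
  have [ne|empty] := pselect (iso_locus AX !=set0); last first.
    exists 1; split=> [|x /irregular[ix _]]; first exact: expr1n.
    by exfalso; apply: empty; exists x.
  have lef' := lef ne; have [[mE pE] _ _ _ _] := lef'; subst m p.
  apply: (irregular_nondegenerate wf ef phi_map _ ek wnd lef' irregular ne).
  by move=> x a g gs; exact: morphism_anchor.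
have near_all x : [set: X] x -> \forall y \near x & K \near +oo,
    nondegenerate_on [set: AX y] (form_comb (pullback phi w) eta (K * epsilon)).
  move=> _; have [reg|nreg] := pselect (regular_at phi w x).
    exact: regular_nondegenerate.
  have H := eN x nreg; near=> y K.
  have K0 : 0 <= K by near: K; apply: nbhs_pinfty_ge; exact: num_real.
  have HK : forall L, 0 <= L -> nondegenerate_on [set: AX y]
      (form_comb (pullback phi w) eta (L * epsilon)) by near: y.
  exact: HK.
have [K nd] : exists K : R, forall y : X,
    nondegenerate_on [set: AX y] (form_comb (pullback phi w) eta (K * epsilon)).
  have := (compact_near_coveringP _).1 Xc R (pinfty_nbhs R) _ _ near_all.
  by move=> /(_ _)/filter_ex[K KP]; exists K => y; exact: KP.
exists (form_comb (pullback phi w) eta (K * epsilon)); split=> //.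
  by apply: form_comb_is_form => //; exact: pullback_is_form.
apply: form_comb_closed => //; first exact: pullback_is_form.
have f0 k : is_form (fun (y : Sigma) (_ : 'I_k -> AS y) => 0 : R).
  split=> [y v j a s t|//|i v]; first by rewrite mulr0 addr0.
  by apply: smooth_fun_cst; exact: triv_open.
exact: (proj2 mor 2%N w (fun _ _ => 0) wf (f0 3%N) wc).
Unshelve. all: by end_near. Qed.
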